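(* Let $k\ge2$, $\mathcal X\subset\mathbb R^n$ open, and fix an augmented architecture (number of layers $L$, widths, and activation functions). Then for all weights and biases $(\operatorname{vecm}(W);\operatorname{stk}(b))\in\mathbb R^{N_W+N_B}$ with $W\in\mathbb W^*$, $b\in\mathbb B$, except possibly for a set of Lebesgue measure zero in $\mathbb R^{N_W+N_B}$, the corresponding augmented MLP $\Phi\in\Xi^k_{\mathrm A,\mathbb W^*}(\mathcal X,\mathbb R)$ is of class $(\mathcal C1)^k(\mathcal X,\mathbb R)$ or $(\mathcal C2)^k(\mathcal X,\mathbb R)$, and hence a Morse function. The same statement holds if $\mathbb W^*$ is replaced by $\mathbb W$.
   Context: MLP setting. An MLP with $L\ge1$ on an open set $\mathcal X\subset\mathbb R^n$ is given by $h_0=x\in\mathcal X$ and, for $l=1,\ldots,L$, $h_l=\widetilde W_l\,\sigma_l(a_l)+\tilde b_l$ with $a_l=W_lh_{l-1}+b_l$, where $W_l\in\mathbb R^{m_l\times n_{l-1}}$, $\widetilde W_l\in\mathbb R^{n_l\times m_l}$, $b_l\in\mathbb R^{m_l}$, $\tilde b_l\in\mathbb R^{n_l}$, all widths are $\ge1$, $n_0=n$, $n_L=1$, and $\sigma_l$ is applied component-wise with components $[\sigma_l]_i:\mathbb R\to\mathbb R$. The network map is $\Phi(x)=h_L\in\mathbb R$. $\Xi^k(\mathcal X,\mathbb R)$ is the set of all such MLPs with $[\sigma_l]_i$ strictly monotone and of class $C^k$ (strict monotonicity of a differentiable component means: its derivative is everywhere $>0$ or everywhere $<0$). Joint enumeration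 of widths and weight matrices: $d_{2l}=n_l$, $d_{2l-1}=m_l$, $V_{2l-1}=W_l$, $V_{2l}=\widetilde W_l$, so $V_j\in\mathbb R^{d_j\times d_{j-1}}$, $j=1,\ldots,2L$. The MLP is augmented if, with $l^*$ the index of the first layer of maximal width, $d_{l^*}\ge n+1$ (and $d_{l^*-1}<d_{l^*}$), $d_{j-1}\le d_j$ for $0<j\le l^*$, and $d_{j-1}\ge d_j$ for $l^*<j\le 2L$. $\Xi^k_{\mathrm A,\mathbb W^*}$ denotes the set of augmented MLPs in $\Xi^k$ with $W\in\mathbb W^*$. For fixed widths: $\mathbb W=\prod_{j=1}^{2L}\mathbb R^{d_j\times d_{j-1}}$ is the space of all weight tuples; $\mathbb W^*\subset\mathbb W$ is the set of tuples with $\operatorname{rank}(V_j)=\min\{d_j,d_{j-1}\}$ for all $j$; $\mathbb B=\prod_{j=1}^{2L}\mathbb R^{d_j}$ is the space of bias tuples $b=(b_1,\tilde b_1,\ldots,b_L,\tilde b_L)$. $\operatorname{vecm}:\mathbb W\to\mathbb R^{N_W}$, $N_W=\sum_j d_jd_{j-1}$, and $\operatorname{stk}:\mathbb B\to\mathbb R^{N_B}$, $N_B=\sum_{j=1}^{2L}d_j$, are the bijections stacking all entries into one vector. $(\mathcal C1)^k(\mathcal X,\mathbb R)$: functions $\Phi\in C^k(\mathcal X,\mathbb R)$ with no critical point. $(\mathcal C2)^k(\mathcal X,\mathbb R)$: functions in $C^k(\mathcal X,\mathbb R)$ with at least one critical point and such that the Hessian is non-singular at every critical point. A Morse function is a $C^2$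 function all of whose critical points have non-singular Hessian. *)

(* Defs.v *)
From HB Require Import structures.
From mathcomp Require Import all_boot all_order all_algebra.
From mathcomp Require Import all_classical all_reals all_analysis.

Set Implicit Arguments.
Unset Strict Implicit.
Unset Printing Implicit Defensive.

Import Order.TTheory GRing.Theory Num.Theory.
Import numFieldNormedType.Exports.

Local Open Scope classical_set_scope.
Local Open Scope ring_scope.

(* Functions on an open set X of R^n are total functions on 'cV[R]_n; every
   notion below only depends on their restriction to X when X is open. *)
Section Smoothness.
Context {R : realType}.

Definition unit_vec n (i : 'I_n) : 'cV[R]_n := delta_mx i 0.

Definition partial n (f : 'cV[R]_n -> R) (i : 'I_n) : 'cV[R]_n -> R :=
  fun x => 'D_(unit_vec i) f x.

(* C^k on X: all iterated partial derivatives of order at most k exist and are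
   continuous at every point of X. *)
Fixpoint Ck_on (k : nat) n (X : set 'cV[R]_n) (f : 'cV[R]_n -> R) : Prop :=
  (forall x, X x -> {for x, continuous f}) /\
  if k is k'.+1 then
    (forall i x, X x -> derivable f x (unit_vec i)) /\
    (forall i, Ck_on k' X (partial f i))
  else True.

Definition gradient n (f : 'cV[R]_n -> R) (x : 'cV[R]_n) : 'cV[R]_n :=
  \col_i partial f i x.

Definition hessian n (f : 'cV[R]_n -> R) (x : 'cV[R]_n) : 'M[R]_n :=
  \matrix_(i, j) partial (partial f j) i x.

Definition critical_point n (f : 'cV[R]_n -> R) (x : 'cV[R]_n) : Prop :=
  gradient f x = 0.

Definition nondegenerate_on n (X : set 'cV[R]_n) (f : 'cV[R]_n -> R) : Prop :=
  forall x, X x -> critical_point f x -> hessian f x \in unitmx.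

Definition classC1 (k : nat) n (X : set 'cV[R]_n) (f : 'cV[R]_n -> R) : Prop :=
  Ck_on k X f /\ forall x, X x -> ~ critical_point f x.

Definition classC2 (k : nat) n (X : set 'cV[R]_n) (f : 'cV[R]_n -> R) : Prop :=
  [/\ Ck_on k X f,
      exists2 x, X x & critical_point f x
    & nondegenerate_on X f].

Definition morse n (X : set 'cV[R]_n) (f : 'cV[R]_n -> R) : Prop :=
  Ck_on 2 X f /\ nondegenerate_on X f.

Definition Ck_real (k : nat) (s : R -> R) : Prop :=
  (forall i, (i < k)%N -> forall x, derivable (derive1n i s) x 1) /\
  (forall i, (i <= k)%N -> continuous (derive1n i s)).

Definition strictly_monotone (s : R -> R) : Prop :=
  (forall x, 0 < derive1 s x) \/ (forall x, derive1 s x < 0).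

End Smoothness.

Section NullSets.
Context {R : realType}.

Definition box N (a b : 'rV[R]_N) : set 'rV[R]_N :=
  [set x | forall i, a 0 i <= x 0 i <= b 0 i].

(* The volume of box a b when a <= b coordinatewise. *)
Definition box_volume N (a b : 'rV[R]_N) : R := \prod_i (b 0 i - a 0 i).

(* Lebesgue outer measure on R^N, N > 0 (every cover consists of infinitely
   many, possibly flat, boxes, so the definition is not meant for N = 0). *)
Definition lebesgue_outer N (A : set 'rV[R]_N) : \bar R :=
  ereal_inf [set v | exists a b : nat -> 'rV[R]_N,
    [/\ forall k i, a k 0 i <= b k 0 i,
        A `<=` \bigcup_k box (a k) (b k)
      & v = (\sum_(0 <= k <oo) (box_volume (a k) (b k))%:E)%E]].

(* For sets that are not assumed to be Borel, Lebesgue measure zero means outer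
   measure zero. *)
Definition lebesgue_null N (A : set 'rV[R]_N) : Prop :=
  lebesgue_outer A = 0%E.

End NullSets.

(* An MLP with L layers is described with the joint enumeration of the widths
   d_0, d_1, ..., d_2L, where n_l = d_2l and m_l = d_(2l-1); in particular the
   input dimension n is d 0. The weights V_1, ..., V_2L and the biases are
   indexed from 0: for 0 <= l < L, the entries 2l and 2l+1 of W (resp. b) are
   W_(l+1) and ~W_(l+1) (resp. b_(l+1) and ~b_(l+1)), and act l is
   sigma_(l+1). *)
Section MLP.
Context {R : realType} (L : nat) (d : nat -> nat).

Definition weights : Type := forall j : 'I_L.*2, 'M[R]_(d j.+1, d j).
Definition biases : Type := forall j : 'I_L.*2, 'cV[R]_(d j.+1).
Definition activations : Type := forall l : 'I_L, 'I_(d l.*2.+1) -> R -> R.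

Fact inner_index_subproof (l : 'I_L) : (l.*2 < L.*2)%N.
Proof. by rewrite ltn_double. Qed.

Fact outer_index_subproof (l : 'I_L) : (l.*2.+1 < L.*2)%N.
Proof. by rewrite ltn_Sdouble. Qed.

Definition inner_index (l : 'I_L) : 'I_L.*2 := Ordinal (inner_index_subproof l).
Definition outer_index (l : 'I_L) : 'I_L.*2 := Ordinal (outer_index_subproof l).

Definition dim_weights : nat := (\sum_(j < L.*2) d j.+1 * d j)%N.
Definition dim_biases : nat := (\sum_(j < L.*2) d j.+1)%N.

Variables (act : activations) (W : weights) (b : biases).

Definition layer (l : 'I_L) (h : 'cV[R]_(d l.*2)) : 'cV[R]_(d l.*2.+2) :=
  let a : 'cV[R]_(d l.*2.+1) := W (inner_index l) *m h + b (inner_index l) in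
  W (outer_index l) *m (\col_i act i (a i 0)) + b (outer_index l).

Fixpoint hidden (x : 'cV[R]_(d 0%N)) (l : nat) : (l <= L)%N -> 'cV[R]_(d l.*2) :=
  match l with
  | 0%N => fun _ => x
  | l'.+1 => fun lt_l'L => layer (l := Ordinal lt_l'L) (hidden x (ltnW lt_l'L))
  end.

Definition mlp (d_out : d L.*2 = 1%N) (x : 'cV[R]_(d 0%N)) : R :=
  hidden x (leqnn L) (cast_ord (esym d_out) ord0) 0.

(* W belongs to WW^*. *)
Definition full_rank : Prop :=
  forall j : 'I_L.*2, \rank (W j) = minn (d j.+1) (d j).

Definition vecm : 'rV[R]_dim_weights :=
  \mxrow_(j < L.*2) mxvec (W j).

Definition stk : 'rV[R]_dim_biases :=
  \mxrow_(j < L.*2) (b j)^T.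

Definition params : 'rV[R]_(dim_weights + dim_biases) := row_mx vecm stk.

End MLP.

(* The conditions on depth, widths and activations in the definition of Xi^k;
   the remaining one, n_L = d_2L = 1, is the argument d_out of mlp. *)
Definition Xi_architecture {R : realType} (k L : nat) (d : nat -> nat)
    (act : @activations R L d) : Prop :=
  [/\ (0 < L)%N,
      forall j, (j <= L.*2)%N -> (0 < d j)%N
    & forall l i, Ck_real k (act l i) /\ strictly_monotone (act l i)].

Definition first_max_width (L : nat) (d : nat -> nat) (s : nat) : Prop :=
  [/\ (s <= L.*2)%N,
      forall j, (j <= L.*2)%N -> (d j <= d s)%N
    & forall j, (j < s)%N -> (d j < d s)%N].

Definition augmented (L : nat) (d : nat -> nat) : Prop :=
  exists s, [/\ first_max_width L d s,
      (d 0%N + 1 <= d s)%N /\ (d s.-1 < d s)%N,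
      forall j, (0 < j <= s)%N -> (d j.-1 <= d j)%N
    & forall j, (s < j <= L.*2)%N -> (d j <= d j.-1)%N].

(* Main.v *)
(* Write theta for the parameters and F(x, theta) for the gradient of the network
   in x. F = 0 is equivalent to x being critical, and theta is bad iff the partial
   derivative D_x F, the Hessian, is singular at some zero (x, theta) of F.

   When all weight matrices have full rank, D_theta F is onto at every point: let
   s be the level of maximal width and write F = r V_s Q, where Q is the Jacobian
   matrix of the part of the network before V_s, which is injective, and the row r
   collects the part after V_s, which is nonzero. Varying V_s by D and the bias by
   - D h, with h the input of V_s at x, fixes the values of all levels at x, hence
   r and Q, so that F varies by r D Q, which is arbitrary.

   The projection to theta of the zeros of F where D_x F is singular is therefore a
   null set, by a Sard argument in equal dimensions which needs neither the implicit
   function theorem nor continuity of DF: if v^T D_x F = 0, then u = v^T D_theta F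
   is nonzero and u.(theta' - theta) = o(|x' - x| + |theta' - theta|) along the
   zeros of F, so the bad parameters near theta lie in a thin slab orthogonal to u.
   Rank-deficient weights are null by the same projection lemma, applied to the
   equations v^T V = 0 normalised by v_i = 1. *)
Require Import Defs.
From mathcomp Require Import all_boot all_order all_algebra.
From mathcomp Require Import all_classical all_reals all_analysis.
From mathcomp Require Import ring lra zify.

Set Implicit Arguments.
Unset Strict Implicit.
Unset Printing Implicit Defensive.

Import Order.TTheory GRing.Theory Num.Theory.
Import numFieldNormedType.Exports.

Local Open Scope classical_set_scope.
Local Open Scope ring_scope.

(** * Null sets of R^N *)
Section OuterMeasure.
Context {R : realType} {N : nat}.
Implicit Types (A B : set 'rV[R]_N).

Lemma box_volume_ge0 (a b : 'rV[R]_N) :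
  (forall i, a 0 i <= b 0 i) -> 0 <= box_volume a b.
Proof. by move=> ab; apply: prodr_ge0 => i _; rewrite subr_ge0. Qed.

Lemma lebesgue_outer_ge0 A : (0 <= lebesgue_outer A)%E.
Proof.
apply: le_ereal_inf_tmp => _ [a [b [ab _ ->]]].
by apply: nneseries_ge0 => k _ _; rewrite lee_fin box_volume_ge0.
Qed.

Lemma le_lebesgue_outer A B :
  A `<=` B -> (lebesgue_outer A <= lebesgue_outer B)%E.
Proof.
move=> AB; apply: le_ereal_inf_tmp => _ [a [b [ab Bab ->]]].
apply: ereal_inf_lbound; exists a, b; split => //.
exact: subset_trans Bab.
Qed.

Lemma lebesgue_outer_sigma_subadditive (A : nat -> set 'rV[R]_N) :
  (lebesgue_outer (\bigcup_k A k) <= \sum_(k <oo) lebesgue_outer (A k))%E.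
Proof.
have [[i ioo]|] := pselect (exists i, lebesgue_outer (A i) = +oo%E).
  rewrite (eseries_pinfty _ _ ioo) ?leey// => n _.
  by rewrite -ltNye (lt_le_trans _ (lebesgue_outer_ge0 _)).
rewrite -forallNE => Aoo.
suff add2e (e : {posnum R}) : (lebesgue_outer (\bigcup_n A n) <=
    \sum_(i <oo) lebesgue_outer (A i) + e%:num%:E)%E.
  by apply/lee_addgt0Pr => _/posnumP[].
rewrite (le_trans _ (epsilon_trick _ _ _))//; last first.
  by move=> n; exact: lebesgue_outer_ge0.
(* Cover [A n] with excess at most e / 2^(n+1), so that all excesses together stay below e. *)
pose P n (B : nat -> 'rV[R]_N * 'rV[R]_N) :=
  [/\ forall k i, (B k).1 0 i <= (B k).2 0 i,
      A n `<=` \bigcup_k box (B k).1 (B k).2 &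
      (\sum_(k <oo) (box_volume (B k).1 (B k).2)%:E <=
       lebesgue_outer (A n) + (e%:num / (2 ^ n.+1)%:R)%:E)%E].
have [G PG] : {G & forall n, P n (G n)}.
  apply: (@choice _ _ P) => n; rewrite /P /lebesgue_outer.
  set S := (X in ereal_inf X); move infS : (ereal_inf S) => iS.
  case: iS infS => [r Sr|Soo|Soo].
  - have en1 : 0 < e%:num / (2 ^ n.+1)%:R by [].
    have /(lb_ereal_inf_adherent en1) : ereal_inf S \is a fin_num by rewrite Sr.
    move=> [x [a [b [ab AnB muBx]]] xS].
    by exists (fun k => (a k, b k)); split => //; rewrite -muBx -Sr; exact/ltW.
  - by have := Aoo n; rewrite /lebesgue_outer Soo.
  - by have := lebesgue_outer_ge0 (A n); rewrite /lebesgue_outer -/S Soo.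
pose v (p : nat * nat) := (box_volume (G p.1 p.2).1 (G p.1 p.2).2)%:E.
have v_ge0 p : (0 <= v p)%E.
  by rewrite lee_fin box_volume_ge0// => i; have [] := PG p.1.
apply: (@le_trans _ _ (\esum_(i in setT) v i)).
  apply: ereal_inf_lbound => /=.
  (* A bijection of [nat] with pairs turns the double family of boxes into one sequence. *)
  have /card_esym/ppcard_eqP[f] := card_nat2.
  exists (fun k => (G (f k).1 (f k).2).1), (fun k => (G (f k).1 (f k).2).2).
  split => [k i|t [i _]|]; first by have [] := PG (f k).1.
    have [_ sub _ Ait] := PG i; have [j _ ?] := sub _ Ait.
    by exists (f^-1%FUN (i, j)) => //=; rewrite invK ?inE.
  rewrite nneseries_esumT; last by move=> n; exact: (v_ge0 (f n)).
  have fbij : set_bij setT setT f by [].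
  by rewrite (reindex_esum _ _ _ _ fbij).
have -> : \esum_(i in setT) v i = (\sum_(i <oo) \sum_(j <oo) v (i, j))%E.
  rewrite nneseries_esumT; last by move=> n; exact: nneseries_ge0.
  under [RHS]eq_esum do rewrite nneseries_esumT//.
  rewrite esum_esum//; congr esum.
  by apply/seteqP; split => -[].
by apply: lee_nneseries => [n _ _|n _]; [exact: nneseries_ge0|case: (PG n)].
Qed.

Hypothesis N_gt0 : (0 < N)%N.

Lemma lebesgue_outer_box (a b : 'rV[R]_N) : (forall i, a 0 i <= b 0 i) ->
  (lebesgue_outer (box a b) <= (box_volume a b)%:E)%E.
Proof.
move=> ab; apply: ereal_inf_lbound.
(* Every box after the first is the point 0, of volume 0 because N > 0. *)
exists (fun k => if k == 0%N then a else 0), (fun k => if k == 0%N then b else 0).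
split=> [[|k]//|x abx|]; first by exists 0%N.
rewrite (nneseries_split _ 1) => [|k _]; last first.
  by case: k => [|k]//=; rewrite lee_fin box_volume_ge0.
rewrite add0n big_nat1 /= eseries0 ?adde0// => k k1 _.
rewrite gtn_eqF// /box_volume (bigD1 (Ordinal N_gt0))//=.
by rewrite subrr mul0r.
Qed.

Lemma lebesgue_outer0 : lebesgue_outer (set0 : set 'rV[R]_N) = 0%E.
Proof.
apply/eqP; rewrite eq_le lebesgue_outer_ge0 andbT.
apply: (@le_trans _ _ (lebesgue_outer (box 0 0))).
  exact: le_lebesgue_outer.
rewrite (le_trans (lebesgue_outer_box _))// lee_fin.
by rewrite /box_volume (bigD1 (Ordinal N_gt0))//= subrr mul0r.
Qed.

Lemma lebesgue_outer_subadditive (I : countType) (D : set I)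
    (A : I -> set 'rV[R]_N) :
  (lebesgue_outer (\bigcup_(i in D) A i) <= \esum_(i in D) lebesgue_outer (A i))%E.
Proof.
pose B k := if @pickle_inv I k is Some i then (if i \in D then A i else set0)
            else set0.
have sub : \bigcup_(i in D) A i `<=` \bigcup_k B k.
  by move=> x [i Di Aix]; exists (pickle i) => //; rewrite /B pickleK_inv mem_set.
apply: le_trans (le_lebesgue_outer sub) _.
apply: le_trans (lebesgue_outer_sigma_subadditive _) _.
rewrite nneseries_esumT; last by move=> n; exact: lebesgue_outer_ge0.
rewrite le_eqVlt; apply/orP; left; apply/eqP.
transitivity (\esum_(k in pickle @` D) lebesgue_outer (B k)).
  rewrite [RHS]esum_mkcond; apply: eq_esum => k _.
  case: ifPn => //; rewrite notin_setE => kD.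
  rewrite /B; case E : pickle_inv => [i|]; last exact: lebesgue_outer0.
  case: ifPn => [/set_mem Di|_]; last exact: lebesgue_outer0.
  case: kD; exists i => //; have := @pickle_invK I k.
  by rewrite /oapp E.
rewrite (@reindex_esum _ _ _ D (pickle @` D) pickle); last first.
  by split=> // i j _ _; exact: (pcan_inj pickleK).
by apply: eq_esum => i Di; rewrite /B pickleK_inv mem_set.
Qed.

Lemma lebesgue_outer_finite_subadditive (I : finType) (A : I -> set 'rV[R]_N) :
  (lebesgue_outer (\bigcup_(i in [set: I]) A i) <= \sum_i lebesgue_outer (A i))%E.
Proof.
apply: le_trans (lebesgue_outer_subadditive _ _) _.
rewrite esum_fset; [|exact: finite_finset|by move=> *; exact: lebesgue_outer_ge0].
have -> : [set: I] = [set` index_enum I].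
  by apply/seteqP; split => // i _ /=; exact: mem_index_enum.
by rewrite -fsbig_seq ?index_enum_uniq.
Qed.

Lemma sub_lebesgue_null A B : A `<=` B -> lebesgue_null B -> lebesgue_null A.
Proof.
move=> AB B0; apply/eqP; rewrite eq_le lebesgue_outer_ge0 andbT.
by rewrite -B0 le_lebesgue_outer.
Qed.

Lemma lebesgue_null_bigcup (I : countType) (D : set I) (A : I -> set 'rV[R]_N) :
  (forall i, D i -> lebesgue_null (A i)) -> lebesgue_null (\bigcup_(i in D) A i).
Proof.
move=> A0; apply/eqP; rewrite eq_le lebesgue_outer_ge0 andbT.
by rewrite (le_trans (lebesgue_outer_subadditive _ _))// esum1.
Qed.

Lemma lebesgue_nullU A B :
  lebesgue_null A -> lebesgue_null B -> lebesgue_null (A `|` B).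
Proof.
move=> A0 B0; apply: (@sub_lebesgue_null _ (\bigcup_(b in setT) if b then A else B)).
  by move=> x [Ax|Bx]; [exists true|exists false].
by apply: lebesgue_null_bigcup => -[].
Qed.

End OuterMeasure.

(** * Covering thin slabs by small boxes *)

Section Slab.
Context {R : realType}.

Lemma grid_cell (K : nat) (h y : R) : (0 < K)%N -> 0 <= y <= K%:R * h ->
  exists i : 'I_K, i%:R * h <= y <= i.+1%:R * h.
Proof.
case: K => // K _; elim: K => [|K IH] /andP[y0 yK].
  by exists ord0; rewrite mul0r y0.
have [yK'|/ltW yK'] := leP y (K.+1%:R * h).
  have [|i iy] := IH; first by rewrite y0.
  by exists (widen_ord (leqnSn _) i).
by exists ord_max; rewrite yK' yK.
Qed.

Definition slab N (c u : 'rV[R]_N) (r s : R) : set 'rV[R]_N :=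
  [set z | (forall j, `|z 0 j - c 0 j| <= r) /\
           `|\sum_j u 0 j * (z 0 j - c 0 j)| <= s].

(** As |u_i| = 1, the linear inequality confines coordinate i to a short interval once the other
    coordinates are known up to the mesh of a fine grid. *)
Lemma lebesgue_outer_slab N (i : 'I_N) (c u : 'rV[R]_N) (r s : R) :
  `|u 0 i| = 1 -> (forall j, `|u 0 j| <= 1) -> 0 <= r -> 0 < s ->
  (lebesgue_outer (slab c u r s) <= ((2 * r) ^+ N.-1 * (4 * s))%:E)%E.
Proof.
move=> ui u1 r0 s0.
have N_gt0 : (0 < N)%N by case: N i {c u ui u1} => [[]|].
(* The mesh 2r/K is so fine that moving the other coordinates to a grid corner changes the linear
   form by at most s. *)
have [K [K0 hK]] : exists K : nat, (0 < K)%N /\ N%:R * (2 * r / K%:R) <= s.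
  pose K := (Num.truncn (N%:R * (2 * r) / s)).+1.
  exists K; split => //; rewrite mulrA ler_pdivrMr ?ltr0n// -ler_pdivrMl// mulrC.
  by rewrite ltW// Num.Theory.truncnS_gt.
have KR : 0 < K%:R :> R by rewrite ltr0n.
set eta := 2 * r / K%:R in hK.
have eta0 : 0 <= eta by rewrite divr_ge0// mulr_ge0.
have Keta : K%:R * eta = 2 * r by rewrite mulrC mulfVK// gt_eqF.
have uu : u 0 i * u 0 i = 1 by rewrite -expr2 -real_normK ?num_real// ui expr1n.
(* The height 4s is also cut into K slices, so that the boxes are indexed by all functions from
   ['I_N] to ['I_K] and have equal volume. *)
pose w := 4 * s / K%:R.
have w0 : 0 <= w by rewrite divr_ge0// mulr_ge0// ltW.
have Kw : K%:R * w = 4 * s by rewrite mulrC mulfVK// gt_eqF.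
(* [m f] is the value of z_i - c_i at which the linear form vanishes when the other coordinates sit
   at their lower grid corners; u_i is its own inverse. *)
pose m (f : 'I_N -> 'I_K) := - u 0 i * \sum_(j | j != i) u 0 j * ((f j)%:R * eta - r).
pose lo (f : {ffun 'I_N -> 'I_K}) : 'rV[R]_N := \row_j
  if j == i then c 0 i + m f - 2 * s + (f j)%:R * w
  else c 0 j - r + (f j)%:R * eta.
pose hi (f : {ffun 'I_N -> 'I_K}) : 'rV[R]_N := \row_j
  if j == i then c 0 i + m f - 2 * s + (f j).+1%:R * w
  else c 0 j - r + (f j).+1%:R * eta.
have lohi f j : lo f 0 j <= hi f 0 j.
  by rewrite !mxE; case: ifP => _; rewrite lerD2l ler_wpM2r// ler_nat.
apply: (@le_trans _ _ (lebesgue_outer (\bigcup_(f in [set: {ffun 'I_N -> 'I_K}])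
  box (lo f) (hi f)))).
  apply: le_lebesgue_outer => z [zr zs].
  have /choice[g hg] j : exists k : 'I_K,
      k%:R * eta <= z 0 j - c 0 j + r <= k.+1%:R * eta.
    apply: grid_cell => //; rewrite Keta.
    by have := zr j; rewrite ler_norml => /andP[? ?]; apply/andP; split; lra.
  (* One s comes from the slab, the other from the grid error. *)
  have mg : `|z 0 i - c 0 i - m g| <= 2 * s.
    have -> : z 0 i - c 0 i - m g = u 0 i * (\sum_j u 0 j * (z 0 j - c 0 j)
        - \sum_(j | j != i) u 0 j * (z 0 j - c 0 j + r - (g j)%:R * eta)).
      rewrite (bigD1 i)//= /m.
      set S1 := \sum_(j | j != i) u 0 j * (z 0 j - c 0 j).
      set S2 := \sum_(j | j != i) u 0 j * ((g j)%:R * eta - r).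
      rewrite (_ : \sum_(j | _) _ = S1 - S2); last first.
        by rewrite -sumrB; apply: eq_bigr => j _; ring.
      transitivity ((u 0 i * u 0 i) * (z 0 i - c 0 i) + u 0 i * S2); last by ring.
      by rewrite uu; ring.
    rewrite normrM ui mul1r (le_trans (ler_normB _ _))//.
    have -> : 2 * s = s + s by ring.
    rewrite lerD// (le_trans _ hK)// (le_trans (ler_norm_sum _ _ _))//.
    rewrite (@le_trans _ _ (\sum_(j < N | j != i) eta))//.
      apply: ler_sum => j _; rewrite normrM -[leRHS]mul1r ler_pM//.
      have /andP[h1 h2] := hg j; rewrite ger0_norm ?subr_ge0// lerBlDr.
      by rewrite (le_trans h2)// -natr1 mulrDl mul1r addrC.
    rewrite sumr_const -[leLHS]mulr_natl ler_wpM2r// ler_nat.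
    by rewrite (leq_trans (max_card _))// card_ord.
  have [k hk] : exists k : 'I_K,
      k%:R * w <= z 0 i - c 0 i - m g + 2 * s <= k.+1%:R * w.
    apply: grid_cell => //; rewrite Kw.
    by have := mg; rewrite ler_norml => /andP[? ?]; apply/andP; split; lra.
  exists [ffun j => if j == i then k else g j] => // j.
  have mE : m [ffun j => if j == i then k else g j] = m g.
    by rewrite /m; congr (_ * _); apply: eq_bigr => l /negbTE li; rewrite ffunE li.
  rewrite !mxE ffunE mE; case: eqP => [->|_].
    by case/andP: hk => ? ?; apply/andP; split; lra.
  by case/andP: (hg j) => ? ?; apply/andP; split; lra.
apply: le_trans (lebesgue_outer_finite_subadditive N_gt0 _) _.
apply: (@le_trans _ _ (\sum_(f : {ffun 'I_N -> 'I_K}) (eta ^+ N.-1 * w)%:E)%E).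
  apply: lee_sum => f _; apply: le_trans (lebesgue_outer_box N_gt0 (lohi f)) _.
  rewrite lee_fin /box_volume (bigD1 i)//= !mxE eqxx.
  rewrite (eq_bigr (fun=> eta)); last first.
    by move=> j /negbTE ji; rewrite !mxE ji -natr1; ring.
  rewrite prodr_const cardC1 card_ord mulrC -natr1.
  by rewrite [X in _ * X](_ : _ = w)//; ring.
rewrite sumEFin lee_fin sumr_const -[leLHS]mulr_natl.
have -> : #|{ffun 'I_N -> 'I_K}| = (K ^ N)%N by rewrite card_ffun !card_ord.
rewrite natrX -(prednK N_gt0) [K%:R ^+ _]exprSr prednK// mulrACA -exprMn.
by rewrite Keta Kw.
Qed.

End Slab.

(** * Kraft's inequality for prefix-free codes *)

Section Kraft.
Context {R : realType} {C : finType}.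

(** Induction on a bound for the word lengths. The empty word can only be alone in the code;
    otherwise split by first letters: the tails behind a letter are again prefix-free, so each
    letter contributes at most 1/|C|. *)
Lemma kraft_inequality (A : seq (seq C)) : uniq A ->
  {in A &, forall v w, prefix v w -> v = w} ->
  \sum_(w <- A) (#|C|%:R^-1) ^+ size w <= 1 :> R.
Proof.
set q : R := _^-1.
have [n] : exists n, forall w, w \in A -> (size w < n)%N.
  by exists (\max_(w <- A) size w).+1 => w wA; rewrite ltnS leq_bigmax_seq.
elim: n A => [|n IH] A lA uA pA.
  by case: A lA {uA pA} => [|w A] lA; [rewrite big_nil|have := lA w (mem_head _ _)].
have [A0|A0] := boolP ([::] \in A).
  have pA1 : perm_eq A [:: [::]].
    apply: uniq_perm => // w; rewrite inE; apply/idP/eqP => [wA|->//].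
    exact/esym/(pA [::] w A0 wA)/prefix0s.
  by rewrite (perm_big _ pA1) big_seq1.
have C0 w : w \in A -> exists c v, w = c :: v.
  by case: w => [|c v]; [rewrite (negbTE A0)|exists c, v].
have -> : \sum_(w <- A) q ^+ size w =
    \sum_(c in C) \sum_(w <- A | ohead w == Some c) q ^+ size w.
  under [RHS]eq_bigr do rewrite big_mkcond.
  rewrite exchange_big; apply: eq_big_seq => w /C0[c [v ->]].
  by rewrite -big_mkcond (big_pred1 c)// => d /=; rewrite eq_sym.
have [C_eq0|C_gt0] := posnP #|C|.
  rewrite big_pred0// => c; apply/negbTE.
  by have := card0_eq C_eq0 c => ->.
apply: (@le_trans _ _ (\sum_(c in C) q)); last first.
  by rewrite sumr_const -mulr_natl mulfV// pnatr_eq0 -lt0n.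
apply: ler_sum => c _.
pose B := [seq behead w | w <- A & ohead w == Some c].
have inB v : (v \in B) = (c :: v \in A).
  apply/mapP/idP => [[w]|cvA]; last by exists (c :: v) => //; rewrite mem_filter eqxx.
  by rewrite mem_filter; case: w => //= d w /andP[/eqP[->] ? ->].
have -> : \sum_(w <- A | ohead w == Some c) q ^+ size w = q * \sum_(v <- B) q ^+ size v.
  rewrite big_map big_filter mulr_sumr; apply: eq_bigr => -[]//= d w _.
  by rewrite exprS.
rewrite -[leRHS]mulr1 ler_wpM2l ?invr_ge0//; apply: IH.
- by move=> v; rewrite inB => /lA.
- rewrite map_inj_in_uniq ?filter_uniq// => v w; rewrite !mem_filter.
  by case: v w => [|x v] [|y w] //= /andP[/eqP[->] _] /andP[/eqP[->] _] ->.
- move=> v w; rewrite !inB => vA wA vw.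
  by have := pA _ _ vA wA; rewrite /= eqxx => /(_ vw)[].
Qed.

End Kraft.

(** * Binary words as addresses of dyadic cubes *)

Section BinaryWords.
Context {R : realType} {N : nat}.
Implicit Types x y : 'rV[R]_N.

(** A letter collects one binary digit of every coordinate, so that on the unit cube a word of
    length m names a dyadic cube of side 2^-m, and its prefixes name larger cubes. *)
Definition first_digits x : {ffun 'I_N -> bool} := [ffun i => 2^-1 <= x 0 i].

Definition shift_digits x : 'rV[R]_N := \row_i (2 * x 0 i - (first_digits x i)%:R).

Fixpoint binary_word (m : nat) x : seq {ffun 'I_N -> bool} :=
  if m is m'.+1 then first_digits x :: binary_word m' (shift_digits x) else [::].

Lemma size_binary_word m x : size (binary_word m x) = m.
Proof. by elim: m x => //= m IH x; rewrite IH. Qed.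

Lemma take_binary_word m n x : (m <= n)%N ->
  take m (binary_word n x) = binary_word m x.
Proof. by elim: n m x => [|n IH] [|m] x //= mn; rewrite IH. Qed.

Lemma binary_word_dist m x y :
  (forall i, 0 <= x 0 i < 1) -> (forall i, 0 <= y 0 i < 1) ->
  binary_word m x = binary_word m y -> forall i, `|x 0 i - y 0 i| <= 2^-1 ^+ m.
Proof.
elim: m x y => [|m IH] x y x01 y01 /=.
  move=> _ i; rewrite expr0 ler_norml; have := x01 i; have := y01 i; lra.
have shift01 (z : 'rV[R]_N) : (forall i, 0 <= z 0 i < 1) ->
    forall j, 0 <= shift_digits z 0 j < 1.
  move=> z01 j; rewrite !mxE ffunE; have := z01 j.
  by case: (leP 2^-1 (z 0 j)) => /= ? /andP[? ?]; apply/andP; split; lra.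
move=> [/ffunP dxy] /IH IHxy i.
have := IHxy (shift01 _ x01) (shift01 _ y01) i.
rewrite !mxE dxy exprS => h.
rewrite (_ : x 0 i - y 0 i = 2^-1 * (2 * x 0 i - (first_digits y i)%:R -
  (2 * y 0 i - (first_digits y i)%:R))); last by field.
by rewrite normrM ger0_norm ?invr_ge0// ler_wpM2l// invr_ge0.
Qed.

End BinaryWords.

(** * Sard lemma *)
Section MatrixNorm.
Context {R : realType}.

Lemma le_mx_norm m n (A : 'M[R]_(m, n)) (r : R) :
  0 <= r -> (forall i j, `|A i j| <= r) -> `|A| <= r.
Proof.
move=> r0 Ar; rewrite /Num.norm/= mx_normrE.
by apply: bigmax_le => // -[i j] _; exact: Ar.
Qed.

Lemma mx_norm_entry m n (A : 'M[R]_(m, n)) i j : `|A i j| <= `|A|.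
Proof.
rewrite [leRHS]/Num.norm/= mx_normrE.
exact: (le_bigmax _ (fun ij => `|A ij.1 ij.2|) (i, j)).
Qed.

End MatrixNorm.

Section SardUnitCube.
Context {R : realType} {N : nat} (T : Type) (E : set T).
Variables (alpha beta : T -> 'rV[R]_N) (M : R).
Hypothesis N_gt0 : (0 < N)%N.
Hypothesis M_ge0 : 0 <= M.
Hypothesis alpha01 : forall t, E t -> forall i, 0 <= alpha t 0 i < 1.
Hypothesis lip : forall t t', E t -> E t' ->
  forall i, `|beta t' 0 i - beta t 0 i| <= M * `|alpha t' - alpha t|.
Hypothesis flat : forall t, E t -> exists2 u : 'rV[R]_N, u != 0 &
  forall e, 0 < e -> exists2 del, 0 < del & forall t', E t' ->
    `|alpha t' - alpha t| < del ->
    `|\sum_j u 0 j * (beta t' 0 j - beta t 0 j)| <= e * `|alpha t' - alpha t|.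

Let C := {ffun 'I_N -> bool}.

(* One centre t per word suffices: the slab around its image contains the images
   of all points of E with the same word. Each point of E is covered by its shortest
   good prefix; the selected words are prefix-free, so by Kraft's inequality the
   total volume of their cubes is at most 1. *)
Definition good_word (e : R) (w : seq C) := exists t (u : 'rV[R]_N) i,
  [/\ E t, binary_word (size w) (alpha t) = w,
    `|u 0 i| = 1, forall j, `|u 0 j| <= 1 &
     forall t', E t' -> `|alpha t' - alpha t| <= 2^-1 ^+ size w ->
     `|\sum_j u 0 j * (beta t' 0 j - beta t 0 j)| <= e * 2^-1 ^+ size w].

Definition selected_word e w :=
  good_word e w /\ forall k, (k < size w)%N -> ~ good_word e (take k w).

Lemma selected_word_prefix e v w :
  selected_word e v -> selected_word e w -> prefix v w -> v = w.
Proof.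
move=> [gv _] [_ hw]; rewrite prefixE => /eqP vw.
have [lt_vw|] := ltnP (size v) (size w).
  by have := hw _ lt_vw; rewrite vw.
by move=> wv; rewrite -vw take_oversize.
Qed.

Lemma good_word_ex e t : 0 < e -> E t ->
  exists m, good_word e (binary_word m (alpha t)).
Proof.
move=> e0 Et; have [u u0 hu] := flat Et.
have [i ui] : exists i, u 0 i != 0.
  by have /matrix0Pn[k [i]] := u0; rewrite ord1 => ?; exists i.
(* Dividing u by its largest modulus gives the normalisation of the slab estimate; the tolerance e
   |u_j| compensates for it. *)
have [j _ jmax] := arg_maxP (fun k => `|u 0 k|) (isT : xpredT i).
have uj : 0 < `|u 0 j| by rewrite (lt_le_trans _ (jmax i isT))// normr_gt0.
have [del del0 hdel] := hu _ (mulr_gt0 e0 uj).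
have [m hm] : exists m : nat, 2^-1 ^+ m < del.
  have : ((fun m => 2^-1 ^+ m : R) @ \oo --> (0 : R))%classic.
    by apply: cvg_expr; rewrite ger0_norm ?invr_ge0// invf_lt1// ltr1n.
  move/cvgrPdist_lt => /(_ _ del0) [m _ hm]; exists m.
  by have := hm m (leqnn m); rewrite /= sub0r normrN ger0_norm.
exists m, t, (`|u 0 j|^-1 *: u), j; rewrite size_binary_word; split => //.
- by rewrite mxE normrM normfV normr_id mulVf// gt_eqF.
- move=> k; rewrite mxE normrM normfV normr_id ler_pdivrMl// mulr1.
  exact: jmax.
- move=> t' Et' tt'.
  have h := hdel t' Et' (le_lt_trans tt' hm).
  under eq_bigr do rewrite mxE -mulrA.
  rewrite -mulr_sumr normrM normfV normr_id ler_pdivrMl//.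
  apply: (le_trans h); rewrite mulrA [`|u 0 j| * e]mulrC.
  by apply: ler_wpM2l => //; rewrite mulr_ge0 ?ltW.
Qed.

(** A selected cube of side r has its image in a slab of radius M r and thickness e r, of volume at
    most (2M)^(N-1) 4e r^N. The r^N sum to at most 1, so the total is O(e). *)
Lemma lebesgue_null_image_unit_cube : lebesgue_null (beta @` E).
Proof.
have bound e : 0 < e ->
    (lebesgue_outer (beta @` E) <= ((2 * M) ^+ N.-1 * (4 * e))%:E)%E.
  move=> e0; set K := _ * (4 * e).
  have K0 : 0 <= K.
    apply: mulr_ge0; first by apply: exprn_ge0; exact: mulr_ge0.
    by apply: mulr_ge0 => //; exact: ltW.
  pose A w := [set beta t | t in [set t | E t /\ binary_word (size w) (alpha t) = w]].
  have sub : beta @` E `<=` \bigcup_(w in selected_word e) A w.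
    move=> _ [t Et <-].
    have /ex_minnP[m] : exists m, `[< good_word e (binary_word m (alpha t)) >].
      by have [m hm] := good_word_ex e0 Et; exists m; apply/asboolP.
    move=> /asboolP hm mmin; exists (binary_word m (alpha t)).
      split=> // k; rewrite size_binary_word => km.
      rewrite take_binary_word ?(ltnW km)// => /asboolP/mmin.
      by rewrite leqNgt km.
    by exists t => //; rewrite size_binary_word.
  apply: le_trans (le_lebesgue_outer sub) _.
  apply: le_trans (lebesgue_outer_subadditive N_gt0 _ _) _.
  apply: (@le_trans _ _ (\esum_(w in selected_word e)
      (K * (#|C|%:R^-1) ^+ size w)%:E)).
    apply: le_esum => w [[t [u [i [Et tw ui u1 hu]]]] _].
    set r := 2^-1 ^+ size w : R.
    have r0 : 0 < r by rewrite exprn_gt0// invr_gt0.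
    apply: (@le_trans _ _ (lebesgue_outer (slab (beta t) u (M * r) (e * r)))).
      apply: le_lebesgue_outer => _ [t' [Et' t'w] <-].
      have dr : `|alpha t' - alpha t| <= r.
        apply: le_mx_norm => [|k j]; first exact: ltW.
        rewrite ord1 !mxE; apply: binary_word_dist; [exact: alpha01..|].
        by rewrite tw t'w.
      split=> [j|]; last exact: hu.
      by rewrite (le_trans (lip Et Et' j))// ler_wpM2l.
    have Mr : 0 <= M * r by rewrite mulr_ge0// ltW.
    apply: le_trans (lebesgue_outer_slab (beta t) ui u1 Mr (mulr_gt0 e0 r0)) _.
    (* There are 2^N letters, so the Kraft weight of a word is the volume of its cube. *)
    have -> : #|C|%:R^-1 ^+ size w = r ^+ N.
      by rewrite card_ffun card_bool card_ord natrX -exprVn -!exprM mulnC.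
    rewrite lee_fin -[in leRHS](prednK N_gt0) exprS /K.
    by rewrite !exprMn le_eqVlt; apply/orP; left; apply/eqP; ring.
  apply: ge_ereal_sup => _ [F [Ff Fsel] <-].
  rewrite fsbig_finite// sumEFin lee_fin -mulr_sumr -[leRHS]mulr1 ler_wpM2l//.
  apply: kraft_inequality => [|v w]; first exact: finmap.fset_uniq.
  rewrite !in_fset_set// !inE => /Fsel hv /Fsel hw.
  exact: selected_word_prefix hv hw.
apply/eqP; rewrite eq_le lebesgue_outer_ge0 andbT.
apply/lee_addgt0Pr => e e0; rewrite add0e.
pose K := (2 * M) ^+ N.-1 * 4 + 1.
have K0 : 0 < K by rewrite ltr_wpDl// mulr_ge0// exprn_ge0// mulr_ge0.
apply: le_trans (bound (e / K) (divr_gt0 e0 K0)) _.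
rewrite lee_fin !mulrA ler_pdivrMr// mulrC ler_wpM2l//; first exact: ltW.
by rewrite lerDl.
Qed.

End SardUnitCube.

Section Sard.
Context {R : realType} {N : nat}.
Hypothesis N_gt0 : (0 < N)%N.

(** Integer translates of the unit cube split E into countably many pieces, and both hypotheses
    involve only differences of alpha. *)
Lemma lebesgue_null_image (T : Type) (E : set T) (alpha beta : T -> 'rV[R]_N)
    (M : R) : 0 <= M ->
  (forall t t', E t -> E t' ->
    forall i, `|beta t' 0 i - beta t 0 i| <= M * `|alpha t' - alpha t|) ->
  (forall t, E t -> exists2 u : 'rV[R]_N, u != 0 &
    forall e, 0 < e -> exists2 del, 0 < del & forall t', E t' ->
      `|alpha t' - alpha t| < del ->
      `|\sum_j u 0 j * (beta t' 0 j - beta t 0 j)| <= e * `|alpha t' - alpha t|) ->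
  lebesgue_null (beta @` E).
Proof.
move=> M0 lip flat.
pose P (z : {ffun 'I_N -> int}) := [set t | E t /\
  forall i, Num.floor (alpha t 0 i) = z i].
have sub : beta @` E `<=` \bigcup_(z in setT) beta @` (P z).
  move=> _ [t Et <-]; exists [ffun i => Num.floor (alpha t 0 i)] => //.
  by exists t => //; split => // i; rewrite ffunE.
apply: sub_lebesgue_null sub _; apply: lebesgue_null_bigcup => // z _.
pose a t : 'rV[R]_N := alpha t - \row_i (z i)%:~R.
have aB t t' : a t' - a t = alpha t' - alpha t by rewrite /a opprB addrA subrK.
apply: (@lebesgue_null_image_unit_cube _ _ _ _ a _ M) => //.
- move=> t [_ tz] i; rewrite !mxE -tz.
  by have := floor_itv (alpha t 0 i); rewrite subr_ge0 ltrBlDl intrD1.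
- by move=> t t' [Et _] [Et' _]; rewrite aB; exact: lip.
- move=> t [Et _]; have [u u0 hu] := flat t Et; exists u => // e /hu[del del0 hdel].
  by exists del => // t' [Et' _]; rewrite aB; exact: hdel.
Qed.

End Sard.

(** * Projections of degenerate zeros *)
Section Projection.
Context {R : realType} {n N : nat}.
Local Notation T := ('cV[R]_n * 'rV[R]_N)%type.
Implicit Types (E : set T) (f : 'I_n -> 'I_N).

Lemma mx_norm_mulmx m p q (A : 'M[R]_(m, p)) (B : 'M[R]_(p, q)) :
  `|A *m B| <= p%:R * `|B| * `|A|.
Proof.
apply: le_mx_norm => [|i j]; first by rewrite !mulr_ge0.
rewrite mxE (le_trans (ler_norm_sum _ _ _))//.
apply: (@le_trans _ _ (\sum_(k < p) `|B| * `|A|)); last first.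
  by rewrite sumr_const card_ord -mulrA mulr_natl.
apply: ler_sum => k _; rewrite normrM mulrC.
by apply: ler_pM => //; exact: mx_norm_entry.
Qed.

Lemma pair_sum_delta (h : T) :
  h = \sum_i h.1 i 0 *: ((delta_mx i 0, 0) : T) +
      \sum_j h.2 0 j *: ((0, delta_mx 0 j) : T).
Proof.
case: h => x y /=; have -> : (x, y) = ((x, 0) : T) + ((0, y) : T).
  by rewrite -[RHS]/(x + 0, 0 + y) addr0 add0r.
congr (_ + _).
  have xE : x = \sum_i x i 0 *: delta_mx i 0.
    by rewrite {1}[x]matrix_sum_delta; apply: eq_bigr => i _; rewrite big_ord1.
  rewrite [in LHS]xE.
  pose inl (x : 'cV[R]_n) : T := (x, 0); rewrite -[LHS]/(inl _).
  have inlD : {morph inl : x y / x + y}.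
    by move=> a b; rewrite /inl -[RHS]/(a + b, 0 + 0) addr0.
  rewrite (big_morph inl inlD (erefl _)); apply: eq_bigr => i _.
  by rewrite /inl -[RHS]/(_ *: _, _ *: _) scaler0.
rewrite [in LHS](matrix_sum_delta y) big_ord1.
pose inr (y : 'rV[R]_N) : T := (0, y); rewrite -[LHS]/(inr _).
have inrD : {morph inr : x y / x + y}.
    by move=> a b; rewrite /inr -[RHS]/(0 + 0, a + b) addr0.
rewrite (big_morph inr inrD (erefl _)); apply: eq_bigr => i _.
by rewrite /inr -[RHS]/(_ *: _, _ *: _) scaler0.
Qed.

(** First-order part of F between t and t', as a row: column k of [A] and of [B] is to hold the x-
    and theta-derivatives of the k-th equation. *)
Definition residual (A : 'M[R]_n) (B : 'M[R]_(N, n)) (t t' : T) : 'rV[R]_n :=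
  (t'.1 - t.1)^T *m A + (t'.2 - t.2) *m B.

(** F vanishes at both points, so its linear part is, up to sign, the differentiability error. *)
Lemma differentiable_residual E (F : 'I_n -> T -> R) (t : T) :
  (forall t', E t' -> forall k, F k t' = 0) ->
  (forall k, differentiable (F k) t) -> E t ->
  let A := \matrix_(i, k) 'D_((delta_mx i 0, 0) : T) (F k) t in
  let B := \matrix_(j, k) 'D_((0, delta_mx 0 j) : T) (F k) t in
  forall e, 0 < e -> exists2 del, 0 < del & forall t', E t' ->
    `|t' - t| < del -> `|residual A B t t'| <= e * `|t' - t|.
Proof.
move=> F0 dF Et A B e e0.
pose P (k : 'I_n) (h : T) := `|F k (h + t) - F k t - 'd (F k) t h| <= e * `|h|.
have H : \forall h \near (0 : T), forall k, P k h.
  apply: (@filter_forall _ _ P (nbhs (0 : T)) (nbhs_filter _)) => k; rewrite /P.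
  have /eqaddoP/(_ e e0) := diff_locally (dF k).
  by apply: filterS => h; rewrite /= !fctE opprD addrA.
have /nbhs_ballP[del /= del0 hdel] := H.
exists del => // t' Et' tt'.
have := hdel (t' - t); rewrite -ball_normE /= sub0r normrN => /(_ tt') hk.
apply: le_mx_norm => [|i k]; first by rewrite mulr_ge0// ltW.
have := hk k; rewrite /P subrK !F0// subrr sub0r normrN.
set h := t' - t; rewrite ord1 {i}.
suff -> : residual A B t t' 0 k = 'd (F k) t h by [].
have hE := pair_sum_delta h; rewrite [in RHS]hE.
rewrite linearD linear_sum /residual !mxE; congr (_ + _).
  by apply: eq_bigr => i _; rewrite linearZ /= -deriveE// !mxE.
by rewrite linear_sum; apply: eq_bigr => i _; rewrite linearZ /= -deriveE// !mxE.
Qed.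

(* The point (x, theta) of a zero set of F is recovered from theta with the n
   coordinates selected by f replaced by x, if these coordinates of theta can be
   solved for in F = 0. *)
Definition exchange f (t : T) : 'rV[R]_N :=
  \row_j if [pick k | f k == j] is Some k then t.1 k 0 else t.2 0 j.

(** f picks n rows of B forming an invertible matrix, so the linearised equations give the
    increments of theta at these coordinates in terms of that of [exchange f], up to an error small
    enough to be absorbed. *)
Lemma exchange_dist_bound E (A : 'M[R]_n) (B : 'M[R]_(N, n)) (t : T)
    (rB : row_full B) : let f := fullrankfun rB in
  (forall e, 0 < e -> exists2 del, 0 < del & forall t', E t' ->
    `|t' - t| < del -> `|residual A B t t'| <= e * `|t' - t|) ->
  exists K : R, exists2 del, 0 < del & forall t', E t' ->
    `|t' - t| < del -> `|t' - t| <= K * `|exchange f t' - exchange f t|.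
Proof.
move=> f hAB.
have f_inj : injective f by exact: fullrankfun_inj.
pose Bf := rowsub f B.
have Bfu : Bf \in unitmx by exact: fullrowsub_unit.
pose c1 : R := n%:R * `|invmx Bf|.
pose c2 : R := n%:R * `|A| + N%:R * `|B|.
have c10 : 0 <= c1 by rewrite mulr_ge0.
have c20 : 0 <= c2 by rewrite addr_ge0// mulr_ge0.
(* Makes c1 * e0 at most 1/2, so that the error term can be absorbed. *)
pose e0 := (2 * (c1 + 1))^-1.
have c1' : 0 < c1 + 1 by rewrite ltr_wpDl.
have e0_gt0 : 0 < e0 by rewrite invr_gt0 mulr_gt0.
have c1e0 : c1 * e0 <= 2^-1.
  by rewrite /e0 invfM mulrCA ger_pMr ?invr_gt0// ler_pdivrMr// mul1r lerDl.
have [del del0 hdel] := hAB _ e0_gt0.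
(* The estimates below amount to |d| <= (1 + 2 c1 c2) |x|, and |h| <= |d| + |x|. *)
exists (2 + 2 * c1 * c2), del => // t' Et' tt'.
have {hdel tt'} := hdel _ Et' tt'.
set x := exchange f t' - exchange f t; set h := t' - t => herr.
pose d : 'rV[R]_n := \row_k h.2 0 (f k).
pose rest : 'rV[R]_N := \row_j if j \in codom f then 0 else h.2 0 j.
have xf k : x 0 (f k) = h.1 k 0.
  rewrite !mxE; case: pickP => [l /eqP/f_inj -> //|/(_ k)].
  by rewrite eqxx.
have xj j : j \notin codom f -> x 0 j = h.2 0 j.
  move=> jf; rewrite !mxE; case: pickP => // l /eqP lj.
  by rewrite -lj codom_f in jf.
have h1 : `|h.1| <= `|x|.
  by apply: le_mx_norm => // i j; rewrite ord1 -xf mx_norm_entry.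
have hrest : `|rest| <= `|x|.
  apply: le_mx_norm => // i j; rewrite [rest _ _]mxE; case: ifPn => [_|jf].
    by rewrite normr0.
  by rewrite -xj// mx_norm_entry.
have h2 : `|h.2| <= `|d| + `|x|.
  apply: le_mx_norm => [|i j]; first by rewrite addr_ge0.
  rewrite ord1; have [/codomP[k ->]|jf] := boolP (j \in codom f).
    apply: (@le_trans _ _ `|d|); last by rewrite lerDl.
    by have := mx_norm_entry d 0 k; rewrite [d _ _]mxE.
  apply: (@le_trans _ _ `|x|); last by rewrite lerDr.
  by rewrite -xj// mx_norm_entry.
have hh : `|h| <= `|d| + `|x|.
  by rewrite prod_normE ge_max h2 andbT (le_trans h1)// lerDr.
have hB : h.2 *m B = d *m Bf + rest *m B.
  apply/rowP => l; rewrite [LHS]mxE [RHS]mxE [(d *m Bf) _ _]mxE [(rest *m B) _ _]mxE.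
  rewrite (bigID (mem (codom f)))/=; congr (_ + _).
    rewrite -big_uniq/=; last by rewrite map_inj_uniq ?enum_uniq.
    by rewrite big_image; apply: eq_bigr => k _; rewrite [d _ _]mxE [Bf _ _]mxE.
  rewrite [RHS](bigID (mem (codom f)))/= [X in _ = X + _]big1 ?add0r.
    by apply: eq_bigr => j /negbTE jf; rewrite [rest _ _]mxE jf.
  by move=> j jf; rewrite [rest _ _]mxE jf mul0r.
have hd : `|d| <= c1 * (e0 * `|h| + c2 * `|x|).
  have -> : d = (residual A B t t' - (h.1)^T *m A - rest *m B) *m invmx Bf.
    rewrite /residual hB -[d in LHS](mulmxK Bfu); congr (_ *m _).
    rewrite [X in X - _]addrAC subrr add0r addrK.
    by [].
  apply: (le_trans (mx_norm_mulmx _ _)); rewrite ler_wpM2l//.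
  rewrite -addrA -opprD (le_trans (ler_normB _ _))// lerD// mulrDl.
  rewrite (le_trans (ler_normD _ _))// lerD// (le_trans (mx_norm_mulmx _ _))//.
    rewrite ler_wpM2l ?mulr_ge0// (le_trans _ h1)//.
    by apply: le_mx_norm => // i j; rewrite mxE mx_norm_entry.
  by rewrite ler_wpM2l ?mulr_ge0.
have : c1 * e0 * `|h| <= 2^-1 * (`|d| + `|x|).
  by apply: ler_pM => //; rewrite mulr_ge0// ltW.
rewrite mulrDr mulrA in hd; nra.
Qed.

(* Splitting E into countably many such pieces before the precision e of the
   Sard lemma is chosen makes x and theta Lipschitz in exchange f (x, theta). *)
Definition lipschitz_piece E f m : set T := [set t | E t /\ forall t', E t' ->
  `|t' - t| <= m.+1%:R^-1 -> `|t' - t| <= m%:R * `|exchange f t' - exchange f t|].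

Hypothesis N_gt0 : (0 < N)%N.

(** On each of countably many pieces the Sard lemma applies with alpha = [exchange f] and beta =
    theta. *)
Lemma lebesgue_null_projection E (F : 'I_n -> T -> R) :
  (forall t, E t -> forall k, F k t = 0) ->
  (forall t, E t -> forall k, differentiable (F k) t) ->
  (forall t, E t ->
    \matrix_(i, k) 'D_((delta_mx i 0, 0) : T) (F k) t \notin unitmx) ->
  (forall t, E t -> forall w : 'rV[R]_n, exists dth,
    forall k, 'D_((0, dth) : T) (F k) t = w 0 k) ->
  lebesgue_null (snd @` E).
Proof.
move=> F0 dF singA surjB.
pose A t := \matrix_(i, k) 'D_((delta_mx i 0, 0) : T) (F k) t.
pose B t := \matrix_(j, k) 'D_((0, delta_mx 0 j) : T) (F k) t.
have hAB t : E t -> forall e, 0 < e -> exists2 del, 0 < del & forall t', E t' ->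
    `|t' - t| < del -> `|residual (A t) (B t) t t'| <= e * `|t' - t|.
  by move=> Et; apply: differentiable_residual => //; exact: dF.
(* Surjectivity of the theta-derivative, tested on unit vectors, provides a left inverse of B. *)
have rB t : E t -> row_full (B t).
  move=> Et; apply/row_fullP.
  have /choice[G hG] k : exists dth : 'rV[R]_N, dth *m B t = delta_mx 0 k.
    have [dth hdth] := surjB t Et (delta_mx 0 k); exists dth.
    apply/rowP => l; rewrite -hdth mxE.
    rewrite deriveE; last exact: dF.
    rewrite (pair_sum_delta (0, dth)) [X in X + _]big1 ?add0r => [|i _]; last first.
      by rewrite mxE scale0r.
    rewrite linear_sum; apply: eq_bigr => j _.
    by rewrite linearZ /= mxE deriveE//; exact: dF.
  exists (\matrix_k G k); apply/row_matrixP => k.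
  by rewrite row_mul rowK hG rowE mulmx1.
(* A piece fixes f, an integer m and cells of side 1/(m+1) for x and theta, so that any two of its
   points are close enough for the Lipschitz bound. *)
pose P (p : {ffun 'I_n -> 'I_N} * nat * {ffun 'I_n -> int} * {ffun 'I_N -> int}) :=
  [set t | lipschitz_piece E p.1.1.1 p.1.1.2 t /\
   (forall i, Num.floor (p.1.1.2.+1%:R * t.1 i 0) = p.1.2 i) /\
   (forall j, Num.floor (p.1.1.2.+1%:R * t.2 0 j) = p.2 j)].
have sub : snd @` E `<=` \bigcup_(p in setT) snd @` (P p).
  move=> _ [t Et <-].
  have [K [del del0 hK]] := @exchange_dist_bound E _ _ _ (rB t Et) (hAB t Et).
  have [m [mdel mK]] : exists m : nat, m.+1%:R^-1 < del /\ K <= m%:R.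
    exists (maxn (Num.truncn del^-1) (Num.truncn K).+1); split.
      rewrite invf_plt ?posrE//; apply: (lt_le_trans (Num.Theory.truncnS_gt _)).
      by rewrite ler_nat ltnS leq_maxl.
    by rewrite (le_trans (ltW (Num.Theory.truncnS_gt _)))// ler_nat leq_maxr.
  exists ([ffun k => fullrankfun (rB t Et) k], m,
    [ffun i => Num.floor (m.+1%:R * t.1 i 0)],
    [ffun j => Num.floor (m.+1%:R * t.2 0 j)]) => //.
  exists t => //; split => /=; last by split=> i; rewrite ffunE.
  split => // t' Et' tt'.
  have -> : exchange [ffun k => fullrankfun (rB t Et) k] =
            exchange (fullrankfun (rB t Et)).
    by congr exchange; apply/funext => k; rewrite ffunE.
  apply: (le_trans (hK _ Et' (le_lt_trans tt' mdel))).
  by rewrite ler_wpM2r.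
apply: (sub_lebesgue_null sub); apply: lebesgue_null_bigcup => //.
move=> [[[f m] z1] z2] _; rewrite {sub}/P /=; set Q := [set t | _].
have QE t : Q t -> E t by case=> -[].
have floor_eq (a b : R) : Num.floor (m.+1%:R * a) = Num.floor (m.+1%:R * b) ->
    `|b - a| <= m.+1%:R^-1.
  move=> ab; rewrite -[leRHS]mulr1 ler_pdivlMl ?ltr0n//.
  rewrite -[X in X * _]ger0_norm// -normrM mulrBr ltW//.
  have := floor_itv (m.+1%:R * a); have := floor_itv (m.+1%:R * b).
  rewrite ab intrD1 => /andP[? ?] /andP[? ?].
  by rewrite ltr_norml; apply/andP; split; lra.
have lip t t' : Q t -> Q t' ->
    `|t' - t| <= m%:R * `|exchange f t' - exchange f t|.
  move=> [[Et lipt] [t1 t2]] [[Et' _] [t1' t2']]; apply: lipt => //.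
  rewrite prod_normE ge_max; apply/andP; split; apply: le_mx_norm => // i j.
    by rewrite ord1 !mxE; apply: floor_eq; rewrite t1 t1'.
  by rewrite ord1 !mxE; apply: floor_eq; rewrite t2 t2'.
apply: (@lebesgue_null_image _ _ N_gt0 _ Q (exchange f) snd m%:R) => //.
  move=> t t' Qt Qt' i; apply: (le_trans _ (lip _ _ Qt Qt')).
  rewrite prod_normE le_max; apply/orP; right.
  by have := mx_norm_entry (t'.2 - t.2) 0 i; rewrite !mxE.
move=> t Qt; have Et := QE _ Qt.
(* A kernel vector v of A removes the x-part of the linearised equations and leaves the flat
   direction B v, nonzero because B has a left inverse. *)
have /det0P[v v0 vA] : \det (A t)^T == 0.
  by rewrite det_tr; have := singA t Et; rewrite unitmxE unitfE negbK.
have Av : A t *m v^T = 0 by rewrite -[A t]trmxK -trmx_mul vA trmx0.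
exists (B t *m v^T)^T.
  apply: contra_neq v0 => /(congr1 trmx); rewrite trmxK trmx0 => Bv.
  have /row_fullP[B' BB'] := rB t Et.
  by rewrite -[v]trmxK -[v^T]mul1mx -BB' -mulmxA Bv mulmx0 trmx0.
move=> e e0; pose c : R := n%:R * `|v^T|.
have c0 : 0 <= c by rewrite mulr_ge0.
(* c comes from multiplying by v, and m + 1 converts the distance of points into that of their
   [exchange f]; the added ones keep c' positive. *)
pose c' := (c + 1) * m.+1%:R.
have c'0 : 0 < c' by rewrite mulr_gt0// ltr_wpDl.
have [del del0 hdel] := hAB t Et (e / c') (divr_gt0 e0 c'0).
exists (del / m.+1%:R); first by rewrite divr_gt0.
move=> t' Qt' tt'; have Et' := QE _ Qt'.
have tt'2 := lip _ _ Qt Qt'.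
have mS : m%:R <= m.+1%:R :> R by rewrite ler_nat.
set x := `|exchange f t' - exchange f t| in tt' tt'2 *.
have x0 : 0 <= x by exact: normr_ge0.
have tt'3 : `|t' - t| <= m.+1%:R * x by rewrite (le_trans tt'2)// ler_wpM2r.
have res : `|residual (A t) (B t) t t'| <= e / c' * `|t' - t|.
  apply: hdel => //; apply: (le_lt_trans tt'3).
  by rewrite mulrC -ltr_pdivlMr.
have -> : \sum_j (B t *m v^T)^T 0 j * (t'.2 0 j - t.2 0 j) =
    (residual (A t) (B t) t t' *m v^T) 0 0.
  rewrite /residual mulmxDl -!mulmxA Av mulmx0 add0r mxE.
  by apply: eq_bigr => j _; rewrite !mxE mulrC; congr (_ * _); apply: eq_bigr.
apply: (le_trans (mx_norm_entry _ 0 0)); apply: (le_trans (mx_norm_mulmx _ _)).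
rewrite -/c (le_trans (ler_wpM2l c0 res))//.
apply: (@le_trans _ _ (c * (e / c' * (m.+1%:R * x)))).
  have ec' : 0 <= e / c' by rewrite divr_ge0 ?ltW.
  exact: ler_wpM2l c0 _ _ (ler_wpM2l ec' tt'3).
have c1 : 0 < c + 1 by rewrite ltr_wpDl.
have -> : c * (e / c' * (m.+1%:R * x)) = c / (c + 1) * (e * x).
  by rewrite /c'; field; rewrite gt_eqF// addrC natr1 pnatr_eq0.
apply: ler_piMl; first by rewrite mulr_ge0// ltW.
by rewrite ler_pdivrMr// mul1r lerDl.
Qed.

End Projection.

(** * Directional derivatives as one-variable derivatives *)

Section DirectionalDerivatives.
Context {R : realType} {V : normedModType R}.

(** Only the restriction of f to a line matters: one-variable rules apply, and functions agreeing
    along the line have equal derivatives. *)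
Lemma derive_line (f : V -> R) x v :
  'D_v f x = 'D_1 (fun h : R => f (h *: v + x)) 0.
Proof.
rewrite /derive; set g1 := fun h => h^-1 *: _; set g2 := fun h => h^-1 *: _.
suff -> : g1 = g2 by [].
by apply/funext => h; rewrite /g1 /g2 /= addr0 scale0r add0r [_%:A]mulr1.
Qed.

Lemma derive_affine (f : V -> R) x v c :
  (forall h : R, f (h *: v + x) = f x + h * c) -> 'D_v f x = c.
Proof.
move=> fE; rewrite derive_line.
have -> : (fun h : R => f (h *: v + x)) = cst (f x) + c *: id.
  by apply/funext => h; rewrite fE !fctE mulrC.
rewrite deriveD; [|exact: derivable_cst|exact/derivableZ/derivable_id].
by rewrite deriveZ ?derive_cst ?derive_id ?add0r; [exact: mulr1|exact: derivable_id].
Qed.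

Lemma derive_const (f : V -> R) x v :
  (forall h : R, f (h *: v + x) = f x) -> 'D_v f x = 0.
Proof. by move=> fE; apply: derive_affine => h; rewrite fE mulr0 addr0. Qed.

Lemma is_derive_comp_real (g : R -> R) (f : V -> R) x v df :
  is_derive x v f df -> derivable g (f x) 1 ->
  is_derive x v (g \o f) (derive1 g (f x) * df).
Proof.
move=> [fx <-] gx; pose l (h : R) := f (h *: v + x).
have l0 : l 0 = f x by rewrite /l scale0r add0r.
have dl : derivable l 0 1 by exact: (derivable1P _ _ _).1 fx.
have dg : derivable g (l 0) 1 by rewrite l0.
split; last first.
  rewrite derive_line [in RHS]derive_line -[RHS]/(_ * 'D_1 l 0) -!derive1E.
  by rewrite -l0 (derive1_comp dl dg).
apply: (derivable1P _ _ _).2; apply/derivable1_diffP.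
apply: (@differentiable_comp _ _ _ _ l g).
  exact: (derivable1_diffP _ _).1 dl.
exact: (derivable1_diffP _ _).1 dg.
Qed.

Lemma is_derive_sum_fun n (f : 'I_n -> V -> R) x v (df : 'I_n -> R) :
  (forall i, is_derive x v (f i) (df i)) ->
  is_derive x v (fun y => \sum_i f i y) (\sum_i df i).
Proof.
move=> fd; rewrite (_ : (fun y => _) = \sum_i f i); first exact: is_derive_sum.
by apply/funext => y; rewrite fct_sumE.
Qed.

Lemma differentiable_sum_fun n (f : 'I_n -> V -> R) x :
  (forall i, differentiable (f i) x) ->
  differentiable (fun y => \sum_i f i y) x.
Proof.
move=> fd; rewrite (_ : (fun y => _) = \sum_i f i); first exact: differentiable_sum.
by apply/funext => y; rewrite fct_sumE.
Qed.

Lemma differentiable_prod_fun (f g : V -> R) x :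
  differentiable f x -> differentiable g x ->
  differentiable (fun y => f y * g y) x.
Proof. exact: differentiableM. Qed.

Lemma differentiable_add_fun (f g : V -> R) x :
  differentiable f x -> differentiable g x ->
  differentiable (fun y => f y + g y) x.
Proof. exact: differentiableD. Qed.

End DirectionalDerivatives.

Section PairCoordinates.
Context {R : realType} {n N : nat}.
Local Notation T := ('cV[R]_n * 'rV[R]_N)%type.

Lemma differentiable_fst_coord i (t : T) :
  differentiable (fun t : T => t.1 i 0) t.
Proof.
apply: (@differentiable_comp _ _ _ _ (fst : T -> _) (fun x : 'cV[R]_n => x i 0 : R)).
  by apply: linear_differentiable; move=> ?; exact: cvg_fst.
exact: differentiable_coord.
Qed.

Lemma differentiable_snd_coord j (t : T) :
  differentiable (fun t : T => t.2 0 j) t.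
Proof.
apply: (@differentiable_comp _ _ _ _ (snd : T -> _) (fun x : 'rV[R]_N => x 0 j : R)).
  by apply: linear_differentiable; move=> ?; exact: cvg_snd.
exact: differentiable_coord.
Qed.

End PairCoordinates.

(** * Rank-deficient matrices form a null set *)

Section RankDeficient.
Context {R : realType}.

(* The coordinates of x with index i or at least p are dummies: they only pad the
   number of unknowns to the number q of equations, and index i makes the
   derivative in x singular. *)
Lemma lebesgue_null_not_row_free p q N (iota : 'I_p -> 'I_q -> 'I_N) :
  (0 < N)%N -> (p <= q)%N ->
  (forall k j k' j', iota k j = iota k' j' -> k = k' /\ j = j') ->
  lebesgue_null [set th : 'rV[R]_N |
    ~~ row_free (\matrix_(k < p, j < q) th 0 (iota k j))].
Proof.
move=> N_gt0 pq iota_inj.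
pose T := ('cV[R]_q * 'rV[R]_N)%type.
pose w := widen_ord pq.
(* The j-th entry of v^T V, with v_i set to 1 and the other v_k read from x. *)
pose F i j (t : T) := \sum_k (if k == i then 1 else t.1 (w k) 0) * t.2 0 (iota k j).
pose E i := [set t : T | forall j, F i j t = 0].
suff sub : [set th : 'rV[R]_N | ~~ row_free (\matrix_(k < p, j < q) th 0 (iota k j))]
    `<=` \bigcup_(i in [set: 'I_p]) snd @` E i.
  apply: (sub_lebesgue_null sub); apply: lebesgue_null_bigcup => // i _.
  apply: (@lebesgue_null_projection _ _ _ N_gt0 _ (F i)) => //.
  - move=> t _ j; apply: differentiable_sum_fun => k.
    apply: differentiable_prod_fun; last exact: differentiable_snd_coord.
    case: eqP => _; [exact: differentiable_cst|exact: differentiable_fst_coord].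
  - move=> t Et; rewrite unitmxE (expand_det_row _ (w i)) big1 ?unitr0// => k _.
    rewrite mxE derive_const ?mul0r// => h; apply: eq_bigr => l _ /=.
    rewrite !mxE mulr0 add0r; case: (l =P i) => // /eqP li.
    have -> : (w l == w i) = false by rewrite -val_eqE /= val_eqE (negbTE li).
    by rewrite mulr0 add0r.
  (* Row i of the matrix has coefficient 1, so moving it by v moves the equations by v. *)
  - move=> t Et v; exists (\row_l if [pick j | iota i j == l] is Some j then v 0 j else 0).
    move=> j; apply: derive_affine => h; rewrite /F/=.
    set dth := \row_l _.
    have dthE k l : dth 0 (iota k l) = if k == i then v 0 l else 0.
      rewrite mxE; case: pickP => [l' /eqP/iota_inj[<- ->]|/(_ l)]; first by rewrite eqxx.
      by have [->|//] := eqVneq k i; rewrite eqxx.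
    have tE k : (h *: ((0, dth) : T) + t).2 0 (iota k j) =
        h * (if k == i then v 0 j else 0) + t.2 0 (iota k j).
      by rewrite -dthE [LHS]mxE [X in X + _]mxE.
    have xE k : (h *: ((0, dth) : T) + t).1 (w k) 0 = t.1 (w k) 0.
      by rewrite [LHS]mxE [X in X + _]mxE [X in _ * X]mxE mulr0 add0r.
    transitivity (\sum_k ((if k == i then 1 else t.1 (w k) 0) * t.2 0 (iota k j) +
        h * (if k == i then v 0 j else 0))).
      by apply: eq_bigr => k _; rewrite tE xE; case: eqP => _; ring.
    by rewrite big_split -mulr_sumr -big_mkcond big_pred1_eq.
move=> th /= nfree.
have : kermx (\matrix_(k < p, j < q) th 0 (iota k j)) != 0 by rewrite kermx_eq0.
case/matrix0Pn => a [i ai0]; exists i => //.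
pose u := row a (kermx (\matrix_(k < p, j < q) th 0 (iota k j))).
have ui : u 0 i != 0 by rewrite [u _ _]mxE.
have uM : u *m \matrix_(k < p, j < q) th 0 (iota k j) = 0.
  by rewrite -row_mul mulmx_ker row0.
exists (\col_l (if [pick k | w k == l] is Some k then u 0 k / u 0 i else 0), th) => // j.
apply: (mulfI ui); rewrite mulr0 /F mulr_sumr.
rewrite -[RHS](_ : (u *m \matrix_(k < p, j < q) th 0 (iota k j)) 0 j = 0); last first.
  by rewrite uM mxE.
rewrite [RHS]mxE; apply: eq_bigr => k _; rewrite [X in _ = _ * X]mxE mulrA; congr (_ * _).
case: eqP => [->|_]; first by rewrite mulr1.
rewrite /= mxE; case: pickP => [l|/(_ k)]; last by rewrite eqxx.
rewrite -val_eqE /= val_eqE => /eqP ->.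
by rewrite mulrCA mulfV// mulr1.
Qed.

End RankDeficient.

(** * Networks and their Jacobian matrices *)
Section Networks.
Context {R : realType}.

(* The half-layers are treated uniformly: level j+1 is obtained from level j by
   the activation phi j, which is the identity for even j, followed by an affine
   map. *)
Fixpoint net (d : nat -> nat) (phi : forall j, 'I_(d j) -> R -> R)
    (V : forall j, 'M[R]_(d j.+1, d j)) (c : forall j, 'cV[R]_(d j.+1))
    (x : 'cV[R]_(d 0%N)) (j : nat) : 'cV[R]_(d j) :=
  if j is j'.+1 then
    V j' *m (\col_i phi j' i (net phi V c x j' i 0)) + c j'
  else x.

Definition slope (d : nat -> nat) (phi : forall j, 'I_(d j) -> R -> R)
    (V : forall j, 'M[R]_(d j.+1, d j)) (c : forall j, 'cV[R]_(d j.+1))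
    (x : 'cV[R]_(d 0%N)) (j : nat) : 'M[R]_(d j) :=
  diag_mx (\row_i derive1 (phi j i) (net phi V c x j i 0)).

(** The chain rule for [net], taken as a definition; [is_derive_net] identifies it with the
    derivative in x. The recursion exposes the factorisation and the dependence on the
    parameters. *)
Fixpoint jac (d : nat -> nat) (phi : forall j, 'I_(d j) -> R -> R)
    (V : forall j, 'M[R]_(d j.+1, d j)) (c : forall j, 'cV[R]_(d j.+1))
    (x : 'cV[R]_(d 0%N)) (j : nat) : 'M[R]_(d j, d 0%N) :=
  if j is j'.+1 then V j' *m (slope phi V c x j' *m jac phi V c x j') else 1%:M.

Variables (d : nat -> nat) (phi : forall j, 'I_(d j) -> R -> R).
Arguments phi : clear implicits.
Hypothesis dphi : forall j i y, derivable (phi j i) y 1.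

Lemma net_entry V c x j i : net phi V c x j.+1 i 0 =
  (\sum_k V j i k * phi j k (net phi V c x j k 0)) + c j i 0.
Proof.
rewrite /= [LHS]mxE [X in X + _]mxE; congr (_ + _).
by apply: eq_bigr => k _; rewrite [X in _ * X]mxE.
Qed.

Lemma jac_entry V c x j i l : jac phi V c x j.+1 i l =
  \sum_k V j i k * (derive1 (phi j k) (net phi V c x j k 0) * jac phi V c x j k l).
Proof.
rewrite /= [LHS]mxE; apply: eq_bigr => k _; congr (_ * _).
by rewrite /slope mul_diag_mx [LHS]mxE [X in X * _]mxE.
Qed.

Lemma is_derive_net V c x l j i :
  is_derive x (unit_vec l) (fun y => net phi V c y j i 0) (jac phi V c x j i l).
Proof.
elim: j i => [|j IH] i.
  rewrite [jac _ _ _ _ _ _ _]mxE.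
  have dE : forall h : R, (h *: (unit_vec l : 'cV[R]_(d 0%N)) + x) i 0 =
      x i 0 + h * (i == l)%:R.
    by move=> h; rewrite !mxE eqxx andbT addrC.
  split; last exact: derive_affine.
  exact/diff_derivable/differentiable_coord.
rewrite (_ : (fun y => _) = (fun y =>
    \sum_k (V j i k *: (phi j k \o (fun y => net phi V c y j k 0))) y) +
    cst (c j i 0)); last first.
  by apply/funext => y; rewrite net_entry !fctE.
rewrite jac_entry -[X in is_derive _ _ _ X]addr0; apply: is_deriveD.
apply: is_derive_sum_fun => k; apply: is_deriveZ.
exact: is_derive_comp_real.
Qed.

(** Weights, biases and input all depend on one variable, so that joint differentiability in (x,
    theta) is a single induction on the level. *)
Lemma differentiable_net (T : normedModType R) (t : T)
    (V : T -> forall j, 'M[R]_(d j.+1, d j)) (c : T -> forall j, 'cV[R]_(d j.+1))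
    (x : T -> 'cV[R]_(d 0%N)) :
  (forall j i k, differentiable (fun s => V s j i k) t) ->
  (forall j i, differentiable (fun s => c s j i 0) t) ->
  (forall i, differentiable (fun s => x s i 0) t) ->
  forall j i, differentiable (fun s => net phi (V s) (c s) (x s) j i 0) t.
Proof.
move=> dV dc dx; elim=> [|j IH] i; first exact: dx.
rewrite (_ : (fun s => _) = (fun s =>
  (\sum_k V s j i k * phi j k (net phi (V s) (c s) (x s) j k 0)) + c s j i 0));
  last by apply/funext => s; rewrite net_entry.
apply: differentiable_add_fun => //; apply: differentiable_sum_fun => k.
apply: differentiable_prod_fun => //.
apply: (@differentiable_comp _ _ _ _ _ (phi j k)) => //.
exact/derivable1_diffP.
Qed.

Lemma differentiable_jac (T : normedModType R) (t : T)
    (V : T -> forall j, 'M[R]_(d j.+1, d j)) (c : T -> forall j, 'cV[R]_(d j.+1))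
    (x : T -> 'cV[R]_(d 0%N)) :
  (forall j i y, derivable (derive1 (phi j i)) y 1) ->
  (forall j i k, differentiable (fun s => V s j i k) t) ->
  (forall j i, differentiable (fun s => c s j i 0) t) ->
  (forall i, differentiable (fun s => x s i 0) t) ->
  forall j i l, differentiable (fun s => jac phi (V s) (c s) (x s) j i l) t.
Proof.
move=> ddphi dV dc dx; elim=> [|j IH] i l; first exact: differentiable_cst.
rewrite (_ : (fun s => _) = (fun s => \sum_k V s j i k *
  (derive1 (phi j k) (net phi (V s) (c s) (x s) j k 0) * jac phi (V s) (c s) (x s) j k l)));
  last by apply/funext => s; rewrite jac_entry.
apply: differentiable_sum_fun => k; apply: differentiable_prod_fun => //.
apply: differentiable_prod_fun => //.
apply: (@differentiable_comp _ _ _ _ _ (derive1 (phi j k))).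
  exact: differentiable_net.
exact/derivable1_diffP.
Qed.

Lemma row_free_mulmx m n p (A : 'M[R]_(m, n)) (B : 'M[R]_(n, p)) :
  row_free A -> row_free B -> row_free (A *m B).
Proof.
move=> /row_freeP[A' AA'] /row_freeP[B' BB']; apply/row_freeP; exists (B' *m A').
by rewrite -mulmxA (mulmxA B) BB' mul1mx.
Qed.

Lemma row_full_mulmx m n p (A : 'M[R]_(m, n)) (B : 'M[R]_(n, p)) :
  row_full A -> row_full B -> row_full (A *m B).
Proof.
move=> /row_fullP[A' AA'] /row_fullP[B' BB']; apply/row_fullP; exists (B' *m A').
by rewrite -mulmxA (mulmxA A') AA' mul1mx.
Qed.

Hypothesis dphi_neq0 : forall j i y, derive1 (phi j i) y != 0.

Lemma slope_unit V c x j : slope phi V c x j \in unitmx.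
Proof.
rewrite /slope unitmxE det_diag unitfE; apply/prodf_neq0 => i _.
by rewrite mxE.
Qed.

Lemma row_full_jac V c x s : (forall j, (j < s)%N -> row_full (V j)) ->
  row_full (jac phi V c x s).
Proof.
elim: s => [|s IH] fullV; first by rewrite row_full_unit unitmx1.
apply: row_full_mulmx; first exact: fullV.
apply: row_full_mulmx; first by rewrite row_full_unit slope_unit.
by apply: IH => j js; apply: fullV; rewrite ltnS ltnW.
Qed.

(* Compensating a change of the weights by the biases leaves every level of the
   network unchanged at the given point, so that only the weights appearing
   explicitly in the Jacobian matrix vary. *)
Lemma net_compensate V c x (dV : forall j, 'M[R]_(d j.+1, d j)) (h : R) :
  let db j := - (dV j *m \col_i phi j i (net phi V c x j i 0)) in
  forall j, net phi (fun j => V j + h *: dV j) (fun j => c j + h *: db j) x j =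
            net phi V c x j.
Proof.
move=> db; elim=> //= j ->.
by rewrite /db mulmxDl scalerN -scalemxAl addrACA addrC subrr add0r.
Qed.

Lemma eq_slope V c V' c' x j : net phi V' c' x j = net phi V c x j ->
  slope phi V' c' x j = slope phi V c x j.
Proof. by rewrite /slope => ->. Qed.

(** [P] multiplies the weights and slopes after [V s], each with independent rows. It is chosen
    before V' and c', so that one [P] serves for the whole variation. *)
Lemma jac_factor V c x s K :
  (forall j, (s < j < K + s.+1)%N -> row_free (V j)) ->
  exists2 P : 'M[R]_(d (K + s.+1), d s.+1), row_free P &
    forall V' c', (forall j, net phi V' c' x j = net phi V c x j) ->
      (forall j, (s < j)%N -> V' j = V j) ->
      jac phi V' c' x (K + s.+1) =
      P *m (V' s *m (slope phi V c x s *m jac phi V' c' x s)).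
Proof.
elim: K => [|K IH] freeV.
  exists 1%:M; first by rewrite row_free_unit unitmx1.
  by move=> V' c' netE _; rewrite mul1mx /= (eq_slope (netE s)).
have [|P freeP PE] := IH.
  by move=> j /andP[sj jK]; apply: freeV; rewrite sj ltnW.
exists (V (K + s.+1)%N *m (slope phi V c x (K + s.+1)%N *m P)).
  apply: row_free_mulmx; first by apply: (freeV (K + s.+1)%N); lia.
  by apply: row_free_mulmx => //; rewrite row_free_unit slope_unit.
move=> V' c' netE V'E; rewrite [LHS]/= (eq_slope (netE _)) PE// -!mulmxA.
rewrite (V'E (K + s.+1)%N)//.
by lia.
Qed.

(** All slopes are frozen by the compensation, so the Jacobian is exactly affine in h when only
    [V s] moves. *)
Lemma jac_direction V c x s M (i0 : 'I_(d M)) : (s < M)%N -> d M = 1%N ->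
  (forall j, (j < s)%N -> row_full (V j)) ->
  (forall j, (s < j < M)%N -> row_free (V j)) ->
  forall w : 'rV[R]_(d 0%N), exists dV db, forall (h : R) l,
    jac phi (fun j => V j + h *: dV j) (fun j => c j + h *: db j) x M i0 l =
    jac phi V c x M i0 l + h * w 0 l.
Proof.
move=> sM dM fullV freeV w.
have [K MK] : exists K, M = (K + s.+1)%N by exists (M - s.+1)%N; rewrite subnK.
subst M.
set Q := slope phi V c x s *m jac phi V c x s.
have /row_fullP[Q' QQ'] : row_full Q.
  apply: row_full_mulmx; first by rewrite row_full_unit slope_unit.
  exact: row_full_jac.
have [P /row_freeP[P' PP'] PE] := jac_factor c x freeV.
(* One-sided inverses, P P' = 1 and Q' Q = 1, make P D Q equal to the prescribed row. *)
pose D := P' *m (\matrix_(i, l) w 0 l) *m Q'.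
(* The matrix type depends on the level, so [D] is transported along s = j. *)
pose dV j : 'M[R]_(d j.+1, d j) :=
  if s =P j is ReflectT e then eq_rect s (fun j => 'M[R]_(d j.+1, d j)) D j e else 0.
have dVs : dV s = D.
  by rewrite /dV; case: eqP => // e; rewrite (eq_axiomK e).
have dVN j : j != s -> dV j = 0.
  by move=> /eqP js; rewrite /dV; case: eqP => // sj; case: js.
pose db j := - (dV j *m \col_i phi j i (net phi V c x j i 0)).
exists dV, db => h l; have netE := net_compensate V c x dV h.
have jacE j : (j <= s)%N -> jac phi (fun j => V j + h *: dV j)
    (fun j => c j + h *: db j) x j = jac phi V c x j.
  elim: j => //= j IH js; rewrite IH; last exact: ltnW.
  have js' : j != s by rewrite ltn_eqF.
  by rewrite (dVN j js') scaler0 addr0 (eq_slope (netE j)).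
rewrite PE//; last by move=> j sj; rewrite dVN ?scaler0 ?addr0// gtn_eqF.
rewrite jacE// (PE V c)// -/Q dVs mulmxDl mulmxDr [LHS]mxE; congr (_ + _).
rewrite -scalemxAl -scalemxAr mxE; congr (_ * _).
by rewrite /D -!mulmxA QQ' mulmx1 mulmxA PP' mul1mx mxE.
Qed.

End Networks.

(** * Closure properties of C^k functions *)

Section CkClosure.
Context {R : realType}.

Lemma Ck_realS k (s : R -> R) : Ck_real k.+1 s <->
  [/\ forall x, derivable s x 1, continuous s & Ck_real k (derive1 s)].
Proof.
split=> [[ds cs]|[ds cs [dds dcs]]].
  split; [exact: (ds 0%N)|exact: (cs 0%N)|split=> i ik].
    by move=> x; rewrite -derive1Sn; exact: ds.
  by rewrite -derive1Sn; exact: cs.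
split=> -[|i] ik; [exact: ds| |exact: cs|]; rewrite derive1Sn.
  exact: (dds i).
exact: (dcs i).
Qed.

Lemma Ck_real0 (s : R -> R) : Ck_real 0 s <-> continuous s.
Proof. by split=> [[_ /(_ 0%N)]|cs]; [exact|split=> // -[]]. Qed.

Lemma Ck_real_leS k (s : R -> R) : Ck_real k.+1 s -> Ck_real k s.
Proof. by move=> [ds cs]; split=> i ik; [exact/ds/ltnW|exact/cs/leqW]. Qed.

Lemma Ck_real_cst k (a : R) : Ck_real k (cst a).
Proof.
elim: k a => [|k IH] a; first by apply/Ck_real0 => x; exact: cvg_cst.
apply/Ck_realS; split=> [x|x|]; [exact: derivable_cst|exact: cvg_cst|].
have -> : derive1 (cst a : R -> R) = cst 0 by apply/funext => x; rewrite derive1_cst.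
exact: IH.
Qed.

Lemma Ck_real_id k : Ck_real k (id : R -> R).
Proof.
case: k => [|k]; first by apply/Ck_real0 => x; exact: cvg_id.
apply/Ck_realS; split=> [x|x|]; [exact: derivable_id|exact: cvg_id|].
have -> : derive1 (id : R -> R) = cst 1 by apply/funext => x; rewrite derive1_id.
exact: Ck_real_cst.
Qed.

Variable n : nat.
Implicit Types f g : 'cV[R]_n -> R.

(** Networks are C^k on the whole space, so the closure rules are proved on [setT] and restricted to
    X only at the end. *)
Lemma Ck_onT_sub k (X : set 'cV[R]_n) f : Ck_on k setT f -> Ck_on k X f.
Proof.
elim: k f => [|k IH] f /= [cf H]; split=> //; try by move=> x _; exact: cf.
by case: H => df pf; split=> [i x _|i]; [exact: df|exact: IH].
Qed.

Lemma Ck_onS k f : Ck_on k.+1 setT f -> Ck_on k setT f.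
Proof.
elim: k f => [|k IH] f [cf [df pf]]; split=> //.
by split=> // i; apply: IH; exact: pf.
Qed.

Lemma Ck_on_le j k f : (j <= k)%N -> Ck_on k setT f -> Ck_on j setT f.
Proof.
elim: k => [|k IH]; first by rewrite leqn0 => /eqP ->.
by rewrite leq_eqVlt => /predU1P[->//|jk] /Ck_onS; exact: IH.
Qed.

Lemma Ck_on_cst k (a : R) : Ck_on k setT (cst a : 'cV[R]_n -> R).
Proof.
elim: k a => [|k IH] a; split=> //; try by move=> x _; exact: cst_continuous.
split=> [i x _|i]; first exact: derivable_cst.
rewrite (_ : partial _ _ = cst 0)//.
by apply/funext => x; rewrite /partial derive_cst.
Qed.

Lemma Ck_on_coord k (j : 'I_n) : Ck_on k setT (fun x : 'cV[R]_n => x j 0).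
Proof.
case: k => [|k]; split=> //; try by move=> x _; exact: coord_continuous.
split=> [i x _|i]; first exact/diff_derivable/differentiable_coord.
rewrite (_ : partial _ _ = cst (j == i)%:R); first exact: Ck_on_cst.
apply/funext => x; apply: derive_affine => h.
by rewrite !mxE eqxx andbT addrC.
Qed.

Lemma Ck_on_add k f g :
  Ck_on k setT f -> Ck_on k setT g -> Ck_on k setT (fun x => f x + g x).
Proof.
elim: k f g => [|k IH] f g [cf Hf] [cg Hg]; split=> //;
  try by move=> x _; exact: cvgD (cf x I) (cg x I).
case: Hf Hg => [df pf] [dg pg]; split=> [i x _|i].
  exact: derivableD (df i x I) (dg i x I).
rewrite (_ : partial _ _ = (fun x => partial f i x + partial g i x)).
  exact: IH (pf i) (pg i).
by apply/funext => x; exact: deriveD (df i x I) (dg i x I).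
Qed.

Lemma Ck_on_mul k f g :
  Ck_on k setT f -> Ck_on k setT g -> Ck_on k setT (fun x => f x * g x).
Proof.
elim: k f g => [|k IH] f g Cf Cg; have [cf Hf] := Cf; have [cg Hg] := Cg;
  split=> //; try by move=> x _; exact: cvgM (cf x I) (cg x I).
case: Hf Hg => [df pf] [dg pg]; split=> [i x _|i].
  exact: derivableM (df i x I) (dg i x I).
rewrite (_ : partial _ _ = (fun x => f x * partial g i x + g x * partial f i x)).
  apply: Ck_on_add; first exact: IH (Ck_onS Cf) (pg i).
  exact: IH (Ck_onS Cg) (pf i).
by apply/funext => x; exact: deriveM (df i x I) (dg i x I).
Qed.

Lemma Ck_on_sum k m (f : 'I_m -> 'cV[R]_n -> R) :
  (forall i, Ck_on k setT (f i)) -> Ck_on k setT (fun x => \sum_i f i x).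
Proof.
elim: m f => [|m IH] f Cf.
  rewrite (_ : (fun _ => _) = cst 0); first exact: Ck_on_cst.
  by apply/funext => x; rewrite big_ord0.
rewrite (_ : (fun _ => _) =
    (fun x => (\sum_i f (widen_ord (leqnSn m) i) x) + f ord_max x)).
  by apply: Ck_on_add => //; exact: IH.
by apply/funext => x; rewrite big_ord_recr.
Qed.

Lemma Ck_on_comp k (s : R -> R) f :
  Ck_real k s -> Ck_on k setT f -> Ck_on k setT (fun x => s (f x)).
Proof.
elim: k s f => [|k IH] s f Cs Cf; have [cf Hf] := Cf; split=> //;
  try by move=> x _; apply: continuous_comp (cf x I) _; exact: Cs.2 0%N isT _.
have [ds cs Cs'] := (Ck_realS k s).1 Cs.
case: Hf => [df pf].
have D i x : is_derive x (unit_vec i) (s \o f) (derive1 s (f x) * partial f i x).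
  by apply: is_derive_comp_real => //; exact/derivableP/df.
split=> [i x _|i]; first by case: (D i x).
rewrite (_ : partial _ _ = (fun x => derive1 s (f x) * partial f i x)).
  exact: Ck_on_mul (IH _ _ Cs' (Ck_onS Cf)) (pf i).
by apply/funext => x; have [_] := D i x.
Qed.

End CkClosure.

(** * Regularity of networks in the input *)

Section NetworkRegularity.
Context {R : realType}.
Variables (d : nat -> nat) (phi : forall j, 'I_(d j) -> R -> R).
Arguments phi : clear implicits.

Lemma Ck_on_net k V c j i : (forall j i, Ck_real k (phi j i)) ->
  Ck_on k setT (fun x => net phi V c x j i 0).
Proof.
move=> Cphi; elim: j i => [|j IH] i; first exact: Ck_on_coord.
rewrite (_ : (fun _ => _) = (fun x =>
    (\sum_k V j i k * phi j k (net phi V c x j k 0)) + cst (c j i 0) x)); last first.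
  by apply/funext => x; rewrite net_entry.
apply: Ck_on_add; last exact: Ck_on_cst.
apply: Ck_on_sum => l; apply: Ck_on_mul; first exact: Ck_on_cst.
exact: Ck_on_comp.
Qed.

Lemma eq_net V c V' c' x M :
  (forall j, (j < M)%N -> V j = V' j) -> (forall j, (j < M)%N -> c j = c' j) ->
  net phi V c x M = net phi V' c' x M.
Proof.
elim: M => //= M IH VV' cc'; rewrite VV'// cc'// IH// => j jM.
  by apply: VV'; exact: leqW.
by apply: cc'; exact: leqW.
Qed.

(** Makes the extension of weights and biases beyond the last layer immaterial. *)
Lemma eq_jac V c V' c' x M :
  (forall j, (j < M)%N -> V j = V' j) -> (forall j, (j < M)%N -> c j = c' j) ->
  jac phi V c x M = jac phi V' c' x M.
Proof.
elim: M => //= M IH VV' cc'.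
have VM j : (j < M)%N -> V j = V' j by move=> jM; apply: VV'; exact: leqW.
have cM j : (j < M)%N -> c j = c' j by move=> jM; apply: cc'; exact: leqW.
by rewrite (VV' M (ltnSn M)) (IH VM cM) (eq_slope (eq_net _ VM cM)).
Qed.

End NetworkRegularity.

(** * Parameters of the network *)
Section Architecture.
Context {R : realType} {L : nat} {d : nat -> nat}.
Local Notation M := L.*2.
Local Notation N := (dim_weights L d + dim_biases L d)%N.

(** [net] runs over all natural levels, so the finite family is padded by zero. *)
Definition extend_weights (W : @weights R L d) (j : nat) : 'M[R]_(d j.+1, d j) :=
  if pselect (j < M)%N is left jM then W (Ordinal jM) else 0.

Definition extend_biases (b : @biases R L d) (j : nat) : 'cV[R]_(d j.+1) :=
  if pselect (j < M)%N is left jM then b (Ordinal jM) else 0.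

Lemma extend_weightsE W (j : 'I_M) : extend_weights W j = W j.
Proof.
case: j => j jM; rewrite /extend_weights /=; case: pselect => // jM'.
by rewrite (bool_irrelevance jM' jM).
Qed.

Lemma extend_biasesE b (j : 'I_M) : extend_biases b j = b j.
Proof.
case: j => j jM; rewrite /extend_biases /=; case: pselect => // jM'.
by rewrite (bool_irrelevance jM' jM).
Qed.

Lemma hidden_net (phi : forall j, 'I_(d j) -> R -> R) (act : @activations R L d)
    (W : @weights R L d) (b : @biases R L d) x l (lL : (l <= L)%N) :
  (forall l : 'I_L, phi l.*2 = fun _ => id) ->
  (forall l : 'I_L, phi l.*2.+1 = act l) ->
  hidden act W b x lL = net phi (extend_weights W) (extend_biases b) x l.*2.
Proof.
move=> phi_even phi_odd; elim: l lL => // l IH lL.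
pose l' := Ordinal lL.
rewrite [LHS]/= IH /layer -!extend_weightsE -!extend_biasesE.
rewrite -[RHS]/(extend_weights W l.*2.+1 *m (\col_i phi l.*2.+1 i
  ((extend_weights W l.*2 *m (\col_i phi l.*2 i
    (net phi (extend_weights W) (extend_biases b) x l.*2 i 0)) +
    extend_biases b l.*2) i 0)) + extend_biases b l.*2.+1).
rewrite (phi_odd l') (phi_even l').
rewrite (_ : \col_i id _ = net phi (extend_weights W) (extend_biases b) x l.*2)//.
by apply/colP => i; rewrite mxE.
Qed.

(** The identity has derivative 1, so it is an admissible activation at the even levels and beyond
    the network. *)
Lemma half_layer_activations k (act : @activations R L d) :
  (forall l i, Ck_real k (act l i) /\ strictly_monotone (act l i)) ->
  exists phi : forall j, 'I_(d j) -> R -> R,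
    [/\ forall j i, Ck_real k (phi j i) /\ strictly_monotone (phi j i),
        forall l : 'I_L, phi l.*2 = fun _ => id &
        forall l : 'I_L, phi l.*2.+1 = act l].
Proof.
move=> hact.
have id_ok : Ck_real k (id : R -> R) /\ strictly_monotone (id : R -> R).
  by split; [exact: Ck_real_id|left=> x; rewrite derive1_id].
have H j : exists f : 'I_(d j) -> R -> R,
    [/\ forall i, Ck_real k (f i) /\ strictly_monotone (f i),
        ~~ odd j -> f = fun _ => id &
        forall (l : 'I_L) (e : l.*2.+1 = j),
          f = eq_rect _ (fun j => 'I_(d j) -> R -> R) (act l) j e].
  have [[l e]|nl] := pselect (exists l : 'I_L, l.*2.+1 = j); last first.
    exists (fun _ => id); split=> // l e; by case: nl; exists l.
  subst j; exists (act l); split=> //; first by rewrite /= odd_double.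
  move=> l' e; have ll' : l' = l by apply/val_inj/double_inj; case: e.
  by subst l'; rewrite (eq_axiomK e).
exists (fun j => projT1 (cid (H j))); split=> [j i|l|l].
- by case: (projT2 (cid (H j))).
- by case: (projT2 (cid (H l.*2))) => _ + _; apply; rewrite odd_double.
- by case: (projT2 (cid (H l.*2.+1))) => _ _ /(_ l erefl).
Qed.

Definition weights_of (th : 'rV[R]_N) : @weights R L d := fun j =>
  vec_mx (@submxrow _ _ (fun j : 'I_M => (d j.+1 * d j)%N) 1 (lsubmx th) j).

Definition biases_of (th : 'rV[R]_N) : @biases R L d := fun j =>
  (@submxrow _ _ (fun j : 'I_M => d j.+1) 1 (rsubmx th) j)^T.

Definition weight_index (j : 'I_M) (i : 'I_(d j.+1)) (k : 'I_(d j)) : 'I_N :=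
  lshift _ (@tagnat.Rank _ (fun j : 'I_M => (d j.+1 * d j)%N) j (mxvec_index i k)).

Definition bias_index (j : 'I_M) (i : 'I_(d j.+1)) : 'I_N :=
  rshift _ (@tagnat.Rank _ (fun j : 'I_M => d j.+1) j i).

Lemma weights_ofE th j i k : weights_of th j i k = th 0 (weight_index i k).
Proof. by rewrite /weights_of !mxE. Qed.

Lemma biases_ofE th j i : biases_of th j i 0 = th 0 (bias_index i).
Proof. by rewrite /biases_of !mxE. Qed.

Lemma weights_of_affine h th th' j :
  weights_of (h *: th + th') j = h *: weights_of th j + weights_of th' j.
Proof. by apply/matrixP => i k; rewrite weights_ofE !mxE. Qed.

Lemma biases_of_affine h th th' j :
  biases_of (h *: th + th') j = h *: biases_of th j + biases_of th' j.
Proof. by apply/matrixP => i k; rewrite ord1 biases_ofE !mxE. Qed.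

Lemma weights_of_params W b : weights_of (params W b) = W.
Proof.
apply: functional_extensionality_dep => j.
by rewrite /weights_of /params row_mxKl /vecm mxrowK mxvecK.
Qed.

Lemma biases_of_params W b : biases_of (params W b) = b.
Proof.
apply: functional_extensionality_dep => j.
by rewrite /biases_of /params row_mxKr /stk mxrowK trmxK.
Qed.

Lemma weight_index_inj (j : 'I_M) i k i' k' :
  @weight_index j i k = @weight_index j i' k' -> i = i' /\ k = k'.
Proof.
move=> /lshift_inj/(congr1 val)/eqP; rewrite tagnat.eq_Rank eqxx /=.
by move=> /eqP/val_inj/enum_rank_inj[-> ->].
Qed.

Lemma lebesgue_null_rank_deficient : (0 < N)%N ->
  lebesgue_null [set th : 'rV[R]_N | ~ full_rank (weights_of th)].
Proof.
move=> N_gt0.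
pose Z (j : 'I_M) := [set th : 'rV[R]_N |
  \rank (weights_of th j) != minn (d j.+1) (d j)].
apply: (@sub_lebesgue_null _ _ _ (\bigcup_(j in setT) Z j)).
  by move=> th /= /existsNP[j /eqP hj]; exists j.
apply: lebesgue_null_bigcup => // j _.
have [le_d|/ltnW le_d] := leqP (d j.+1) (d j).
  apply: sub_lebesgue_null (lebesgue_null_not_row_free N_gt0 le_d (@weight_index_inj j)).
  move=> th; rewrite /Z /= (minn_idPl le_d); apply: contra.
  rewrite /row_free => /eqP rE; apply/eqP; rewrite -[RHS]rE; congr mxrank.
  by apply/matrixP => i k; rewrite weights_ofE mxE.
(* A tall matrix is handled through its transpose, with the two indices swapped. *)
have inj k i k' i' : @weight_index j i k = @weight_index j i' k' -> k = k' /\ i = i'.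
  by move=> /weight_index_inj[].
apply: sub_lebesgue_null (lebesgue_null_not_row_free N_gt0 le_d inj).
move=> th; rewrite /Z /= (minn_idPr le_d); apply: contra.
rewrite /row_free => /eqP rE; apply/eqP; rewrite -[RHS]rE -mxrank_tr; congr mxrank.
by apply/matrixP => i k; rewrite mxE weights_ofE mxE.
Qed.

Local Notation T := ('cV[R]_(d 0%N) * 'rV[R]_N)%type.

Lemma differentiable_extend_weights (t : T) j i k :
  differentiable (fun s : T => extend_weights (weights_of s.2) j i k) t.
Proof.
have [jM|jM] := pselect (j < M)%N.
  rewrite (_ : (fun s => _) =
      (fun s : T => s.2 0 (@weight_index (Ordinal jM) i k))).
    exact: differentiable_snd_coord.
  by apply/funext => s; rewrite -weights_ofE -extend_weightsE.
rewrite (_ : (fun s => _) = cst 0); first exact: differentiable_cst.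
by apply/funext => s; rewrite /extend_weights; case: pselect => // _; rewrite mxE.
Qed.

Lemma differentiable_extend_biases (t : T) j i :
  differentiable (fun s : T => extend_biases (biases_of s.2) j i 0) t.
Proof.
have [jM|jM] := pselect (j < M)%N.
  rewrite (_ : (fun s => _) = (fun s : T => s.2 0 (@bias_index (Ordinal jM) i))).
    exact: differentiable_snd_coord.
  by apply/funext => s; rewrite -biases_ofE -extend_biasesE.
rewrite (_ : (fun s => _) = cst 0); first exact: differentiable_cst.
by apply/funext => s; rewrite /extend_biases; case: pselect => // _; rewrite mxE.
Qed.

(** The map F of (x, theta): when d_2L = 1, its only row is the gradient of the network in x. *)
Definition theta_jac (phi : forall j, 'I_(d j) -> R -> R)
    (t : T) : 'M[R]_(d M, d 0%N) :=
  jac phi (extend_weights (weights_of t.2)) (extend_biases (biases_of t.2)) t.1 M.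

Lemma differentiable_theta_jac (phi : forall j, 'I_(d j) -> R -> R) i l (t : T) :
  (forall j i y, derivable (phi j i) y 1) ->
  (forall j i y, derivable (derive1 (phi j i)) y 1) ->
  differentiable (fun t : T => theta_jac phi t i l) t.
Proof.
move=> dphi ddphi; apply: differentiable_jac => //.
- exact: differentiable_extend_weights.
- exact: differentiable_extend_biases.
- by move=> i'; exact: differentiable_fst_coord.
Qed.

Lemma theta_jac_direction (phi : forall j, 'I_(d j) -> R -> R) (i0 : 'I_(d M)) (t : T)
    (w : 'rV[R]_(d 0%N)) :
  (forall j i y, derive1 (phi j i) y != 0) -> (0 < d 0%N)%N -> d M = 1%N ->
  augmented L d -> full_rank (weights_of t.2) ->
  exists dth, forall l,
    'D_((0, dth) : T) (fun t : T => theta_jac phi t i0 l) t = w 0 l.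
Proof.
move=> dphi0 d0 dM [s [[sM _ _] [d0s _] incr decr]] fullW.
(* The maximal width is at least n + 1 >= 2, hence not that of the output. *)
have ltsM : (s < M)%N.
  rewrite ltn_neqAle sM andbT; apply/eqP => sE.
  by move: d0s; rewrite sE dM; lia.
set V := extend_weights (weights_of t.2).
have rankV j : (j < M)%N -> \rank (V j) = minn (d j.+1) (d j).
  by move=> jM; rewrite -(fullW (Ordinal jM)) -extend_weightsE.
have [j js|j /andP[sj jM]|dV [db jacE]] := @jac_direction R d phi dphi0 V
    (extend_biases (biases_of t.2)) t.1 s M i0 ltsM dM _ _ w.
(* Weight j maps level j to level j + 1: for j < s the widths do not decrease and the rank is the
   number of columns; for j > s it is the number of rows. *)
- rewrite /row_full rankV; last exact: ltn_trans ltsM.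
  by apply/eqP/minn_idPr; apply: (incr j.+1).
- rewrite /row_free rankV//.
  by apply/eqP/minn_idPl; apply: (decr j.+1); rewrite ltnW.
(* The direction keeps only the variations below level 2L; [eq_jac] takes care of the others. *)
exists (params (fun j : 'I_M => dV j) (fun j : 'I_M => db j)) => l.
apply: derive_affine => h; rewrite /theta_jac -jacE.
congr (fun_of_matrix _ i0 l).
set dth := params _ _.
have dthW : weights_of dth = fun j => dV j by exact: weights_of_params.
have dthB : biases_of dth = fun j => db j by exact: biases_of_params.
rewrite (_ : (h *: ((0, dth) : T) + t).1 = t.1); last by rewrite /= scaler0 add0r.
have dthE : (h *: ((0, dth) : T) + t).2 = h *: dth + t.2 by [].
apply: eq_jac => j jM; rewrite dthE.
  rewrite /V -[j]/(val (Ordinal jM)) !extend_weightsE.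
  by rewrite weights_of_affine dthW addrC.
rewrite -[j]/(val (Ordinal jM)) !extend_biasesE.
by rewrite biases_of_affine dthB addrC.
Qed.

End Architecture.

(** * Generic networks are Morse *)

Theorem theorem3p22 (R : realType) (k : nat) (hk : (2 <= k)%N)
    (L : nat) (d : nat -> nat) (act : @activations R L d)
    (hXi : Xi_architecture k act) (hA : augmented L d)
    (d_out : d L.*2 = 1%N)
    (X : set 'cV[R]_(d 0%N)) (hX : open X) :
  (exists2 Z : set 'rV[R]_(dim_weights L d + dim_biases L d),
      lebesgue_null Z &
    forall (W : @weights R L d) (b : @biases R L d),
      full_rank W -> ~ Z (params W b) ->
      (classC1 k X (mlp act W b d_out) \/ classC2 k X (mlp act W b d_out)) /\
      morse X (mlp act W b d_out)) /\
  (exists2 Z : set 'rV[R]_(dim_weights L d + dim_biases L d),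
      lebesgue_null Z &
    forall (W : @weights R L d) (b : @biases R L d),
      ~ Z (params W b) ->
      (classC1 k X (mlp act W b d_out) \/ classC2 k X (mlp act W b d_out)) /\
      morse X (mlp act W b d_out)).
Proof.
(* One null set serves both statements, as it contains all rank-deficient weights. *)
suff [Z Z0 hZ] : exists2 Z : set 'rV[R]_(dim_weights L d + dim_biases L d),
    lebesgue_null Z &
    forall (W : @weights R L d) (b : @biases R L d), ~ Z (params W b) ->
      (classC1 k X (mlp act W b d_out) \/ classC2 k X (mlp act W b d_out)) /\
      morse X (mlp act W b d_out).
  by split; exists Z => // W b _; exact: hZ.
have [L_gt0 d_gt0 /half_layer_activations[phi [hphi phi_even phi_odd]]] := hXi.
(* The biases of the first half-layer already contribute d_1 > 0 parameters. *)
have N_gt0 : (0 < dim_weights L d + dim_biases L d)%N.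
  have M_gt0 : (0 < L.*2)%N by rewrite double_gt0.
  rewrite addn_gt0; apply/orP; right.
  by rewrite /dim_biases (bigD1 (Ordinal M_gt0))//= addn_gt0 d_gt0.
have phi2 j i : Ck_real 2 (phi j i).
  have [Cphi _] := hphi j i; elim: k hk Cphi {hXi hphi} => // m IH.
  by rewrite leq_eqVlt => /predU1P[<-//|m2] /Ck_real_leS; exact: IH.
have dphi j i y : derivable (phi j i) y 1 by case: (phi2 j i) => /(_ 0%N isT).
have ddphi j i y : derivable (derive1 (phi j i)) y 1.
  by case: (phi2 j i) => /(_ 1%N isT).
have dphi0 j i y : derive1 (phi j i) y != 0.
  by case: (hphi j i) => _ [] /(_ y); [exact: lt0r_neq0|exact: ltr0_neq0].
pose i0 : 'I_(d L.*2) := cast_ord (esym d_out) ord0.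
pose T := ('cV[R]_(d 0%N) * 'rV[R]_(dim_weights L d + dim_biases L d))%type.
pose E := [set t : T |
  [/\ full_rank (weights_of t.2), forall l, theta_jac phi t i0 l = 0 &
   \matrix_(i, l) 'D_((delta_mx i 0, 0) : T) (fun t : T => theta_jac phi t i0 l) t
     \notin unitmx]].
exists ([set th | ~ full_rank (weights_of th)] `|` snd @` E).
  apply: lebesgue_nullU => //; first exact: lebesgue_null_rank_deficient.
  apply: (@lebesgue_null_projection _ _ _ N_gt0 _
    (fun l (t : T) => theta_jac phi t i0 l)) => [t []//|t _ l|t []//|t [fullW _ _] w].
    exact: differentiable_theta_jac.
  exact: theta_jac_direction dphi0 (d_gt0 0%N isT) d_out hA fullW.
move=> W b nZ; set f := mlp act W b d_out; set th := params W b.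
have fullW : full_rank W.
  by apply: contrapT => nW; apply: nZ; left; rewrite /= weights_of_params.
have fE : f = fun x => net phi (extend_weights W) (extend_biases b) x L.*2 i0 0.
  by apply/funext => x; rewrite /f /mlp (hidden_net _ _ _ _ phi_even phi_odd).
have partialE l : partial f l = fun x => theta_jac phi (x, th) i0 l.
  apply/funext => x; rewrite /theta_jac /= weights_of_params biases_of_params fE.
  by have [_] := is_derive_net dphi (extend_weights W) (extend_biases b) x l i0.
have Cf m : (m <= k)%N -> Ck_on m X f.
  move=> mk; apply: Ck_onT_sub; apply: Ck_on_le mk _; rewrite fE.
  by apply: Ck_on_net => j i; case: (hphi j i).
have nondeg : nondegenerate_on X f.
  (* A degenerate critical point x puts (x, th) in [E], hence th in the exceptional set. *)
  move=> x _ crit; apply: contrapT => hess; apply: nZ; right.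
  exists (x, th) => //; split=> /=; first by rewrite weights_of_params.
    move=> l; have := congr1 (fun g : 'cV[R]_(d 0%N) => g l 0) crit.
    by rewrite /gradient !mxE partialE.
  apply/negP; rewrite (_ : \matrix_(i, l) _ = hessian f x)//.
  (* Along (e_i, 0) the parameters stay fixed, so both derivatives are taken of the same
     one-variable function. *)
  apply/matrixP => i l; rewrite !mxE partialE /partial derive_line [RHS]derive_line.
  apply: (congr1 (fun g : R -> R => 'D_1 g 0)); apply/funext => h.
  congr (fun_of_matrix (theta_jac phi _) i0 l).
  by rewrite -[LHS]/(h *: delta_mx i 0 + x, h *: 0 + th) scaler0 add0r.
split; last by split=> //; exact: Cf.
have [ex|nex] := pselect (exists2 x, X x & critical_point f x).
  by right; split=> //; exact: Cf.
by left; split=> [|x Xx cx]; [exact: Cf|apply: nex; exists x].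
Qed.
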